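(* Let $(\tilde{\mathbf{M}},\tilde{\nabla},\tilde{\nabla}^{*},\tilde{g})$ be a dually flat connected statistical manifold of dimension $n+2$ and let $\mathbf{M}$ be a manifold of dimension $n$. Let $f:\mathbf{M}\longrightarrow\tilde{\mathbf{M}}$ be a non-degenerate centro-affine, equiaffine immersion of codimension two, with induced connection $\nabla$ and affine fundamental form $h$ (the coefficient of the unit normal vector field $\xi$ in the Gauss formula). Then the inherited statistical manifold $(\mathbf{M},\nabla,h)$ is conformally-projectively flat.
   Context: All objects are smooth and all affine connections are torsion-free. A statistical manifold $(\mathbf{M},\nabla,g)$ is a pseudo-Riemannian manifold $(\mathbf{M},g)$ with a torsion-free affine connection $\nabla$ such that $\nabla g$ is symmetric, i.e. $(\nabla_X g)(Y,Z)$ is symmetric in $X,Y,Z$. Its dual connection $\nabla^{*}$ is defined by $Xg(Y,Z)=g(\nabla_XY,Z)+g(Y,\nabla^{*}_XZ)$ for all vector fields $X,Y,Z$. The statistical manifold is flat if the curvature tensor of $\nabla$ vanishes. In that case the curvature of $\nabla^{*}$ also vanishes and $(\mathbf{M},\nabla,\nabla^{*},g)$ is called dually flat. Two statistical manifolds $(\mathbf{M},\nabla,g)$ and $(\mathbf{M},\bar{\nabla},\bar{g})$ are conformally-projectively equivalent if there exist two positive functions $\phi,\psi$ on $\mathbf{M}$ such that, for all vector fields $X,Y,Z$, $$\bar{g}(X,Y)=\phi\psi\, g(X,Y),$$ $$g(\bar{\nabla}_XY,Z)=g(\nabla_XY,Z)-d(\log\phi)(Z)\,g(X,Y)+d(\log\psi)(X)\,g(Y,Z)+d(\log\psi)(Y)\,g(X,Z).$$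 A statistical manifold $(\mathbf{M},\nabla,g)$ is conformally-projectively flat if it is conformally-projectively equivalent to a flat statistical manifold in a neighbourhood of an arbitrary point of $\mathbf{M}$. Centro-affine immersions of codimension two: let $(\tilde{\mathbf{M}},\tilde{\nabla},\tilde{\nabla}^{*},\tilde{g})$ be a dually flat statistical manifold of dimension $n+2$ with a fixed affine coordinate system $[\theta^{i}]$ of $\tilde{\nabla}$ on $\tilde{\mathbf{M}}$ (coordinates in which the Christoffel symbols of $\tilde{\nabla}$ vanish), and let $\gamma=\sum_{i=1}^{n+2}\theta^{i}\frac{\partial}{\partial\theta^{i}}$ be the radial vector field. An immersion $f:\mathbf{M}\to\tilde{\mathbf{M}}$ of an $n$-dimensional manifold is a centro-affine immersion of codimension two if there exists a unit normal vector field $\xi$ along $f$ (that is, $\tilde g(\xi,\xi)=1$ and $\tilde g(\xi,f_*X)=0$) such that, at each $p\in\mathbf{M}$, $T_{f(p)}\tilde{\mathbf{M}}=f_*(T_p\mathbf{M})+\mathrm{span}\{\xi\}+\mathrm{span}\{\gamma\}$. The Gauss and Weingarten formulae $$\tilde{\nabla}_Xf_*Y=f_*(\nabla_XY)+h(X,Y)\xi+T(X,Y)\gamma,\qquad \tilde{\nabla}_X\xi=-f_*(SX)+\tau(X)\xi+\sigma(X)\gamma$$ define the induced connection $\nabla$, the affine fundamental forms $h,T$, the affine shape operator $S$ and the transversal connection forms $\tau,\sigma$. The immersion $f$ is non-degenerate if $h$ is non-degenerate, and equiaffine if $\tau=0$. For a non-degenerate equiaffine centro-affine immersion, $(\mathbf{M},\nabla,h)$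 is a statistical manifold, called the inherited statistical manifold. *)

(* Defs.v *)
From mathcomp Require Import all_boot all_order all_algebra.
From mathcomp Require Import all_classical all_reals all_analysis.
Set Implicit Arguments.
Unset Strict Implicit.
Unset Printing Implicit Defensive.
Import Order.TTheory GRing.Theory Num.Theory.
Import numFieldNormedType.Exports.
Local Open Scope classical_set_scope.
Local Open Scope ring_scope.

(* Only used for open U.  Differentiability together with C^k directional
   derivatives in every direction is the usual C^(k+1). *)
Fixpoint Ck_on (R : realType) (V W : normedModType R) (k : nat) (U : set V)
    (F : V -> W) : Prop :=
  match k with
  | 0 => forall x, U x -> {for x, continuous F}
  | k'.+1 => (forall x, U x -> differentiable F x) /\
             (forall v, Ck_on k' U (fun x => 'D_v F x))
  end.

Definition smooth_on (R : realType) (V W : normedModType R) (U : set V)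
    (F : V -> W) : Prop := forall k, Ck_on k U F.

(* The maps are total; their values off cdom and off cmap @` cdom are
   irrelevant. *)
Record chart (R : realType) (n : nat) (T : topologicalType) := Chart {
  cdom : set T;
  cmap :> T -> 'rV[R]_n;
  cinv : 'rV[R]_n -> T;
  cdom_open : open cdom;
  cimg_open : open (cmap @` cdom);
  cmapK : forall p, cdom p -> cinv (cmap p) = p;
  cmap_continuous : forall p, cdom p -> {for p, continuous cmap};
  cinv_continuous : forall x, (cmap @` cdom) x -> {for x, continuous cinv}
}.

Definition compatible (R : realType) (n : nat) (T : topologicalType)
    (c d : chart R n T) : Prop :=
  smooth_on (c @` (cdom c `&` cdom d)) (d \o cinv c) /\
  smooth_on (d @` (cdom c `&` cdom d)) (c \o cinv d).

(* chart_at selects a chart around each point: a tangent vector at p is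
   represented by the row vector of its components in the chart chart_at p.
   Consequently a vector field is a function M -> 'rV_n, whose components in
   another chart are obtained through the differential of the change of
   coordinates (mderiv below). *)
Record manifold (R : realType) (n : nat) := Manifold {
  mcarrier :> topologicalType;
  atlas : set (chart R n mcarrier);
  chart_at : mcarrier -> chart R n mcarrier;
  m_hausdorff : hausdorff_space mcarrier;
  m_countable : @second_countable mcarrier;
  atlas_compatible : forall c d, atlas c -> atlas d -> compatible c d;
  atlas_maximal :
    forall c, (forall d, atlas d -> compatible c d) -> atlas c;
  chart_at_atlas : forall p, atlas (chart_at p);
  chart_at_dom : forall p, cdom (chart_at p) p
}.

(* Derivative at p, along the tangent vector v, of a function with values in a
   normed space.  For a real function it is v(F) = dF(v); for F a chart around
   p it is the vector of components of v in that chart. *)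
Definition mderiv (R : realType) (n : nat) (M : manifold R n)
    (W : normedModType R) (F : M -> W) (p : M) (v : 'rV[R]_n) : W :=
  'D_v (F \o cinv (chart_at p)) (chart_at p p).

Definition pushforward (R : realType) (n m : nat) (M : manifold R n)
    (N : manifold R m) (f : M -> N) (p : M) (v : 'rV[R]_n) : 'rV[R]_m :=
  mderiv (chart_at (f p) \o f) p v.

Definition smooth_fun (R : realType) (n : nat) (M : manifold R n)
    (W : normedModType R) (U : set M) (F : M -> W) : Prop :=
  forall c, atlas c -> smooth_on (c @` (U `&` cdom c)) (F \o cinv c).

Definition smooth_field (R : realType) (n : nat) (M : manifold R n)
    (U : set M) (X : M -> 'rV[R]_n) : Prop :=
  forall c : chart R n M, atlas c ->
    smooth_fun (U `&` cdom c) (fun q => mderiv c q (X q)).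

Definition smooth_map (R : realType) (n m : nat) (M : manifold R n)
    (N : manifold R m) (f : M -> N) : Prop :=
  continuous f /\
  forall d : chart R m N, atlas d -> smooth_fun (f @^-1` cdom d) (d \o f).

(* Smooth vector fields along f: W q is a tangent vector to N at f q. *)
Definition smooth_along (R : realType) (n m : nat) (M : manifold R n)
    (N : manifold R m) (f : M -> N) (W : M -> 'rV[R]_m) : Prop :=
  forall d : chart R m N, atlas d ->
    smooth_fun (f @^-1` cdom d) (fun q => mderiv d (f q) (W q)).

Definition smooth_fun_near (R : realType) (n : nat) (M : manifold R n)
    (p : M) (u : M -> R) : Prop :=
  exists U : set M, [/\ open U, U p & smooth_fun U u].

Definition smooth_field_near (R : realType) (n : nat) (M : manifold R n)
    (p : M) (X : M -> 'rV[R]_n) : Prop :=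
  exists U : set M, [/\ open U, U p & smooth_field U X].

Definition coord_field (R : realType) (n : nat) (M : manifold R n)
    (c : chart R n M) (i : 'I_n) (p : M) : 'rV[R]_n :=
  'D_(delta_mx 0 i) (chart_at p \o cinv c) (c p).

(* [X, Y]^i = X^j d_j Y^i - Y^j d_j X^i, computed at p in the chart
   chart_at p. *)
Definition lie_bracket (R : realType) (n : nat) (M : manifold R n)
    (X Y : M -> 'rV[R]_n) (p : M) : 'rV[R]_n :=
  let comp (Z : M -> 'rV[R]_n) (q : M) := mderiv (chart_at p) q (Z q) in
  mderiv (comp Y) p (X p) - mderiv (comp X) p (Y p).

Definition metric (R : realType) (n : nat) (M : manifold R n) : Type :=
  M -> 'rV[R]_n -> 'rV[R]_n -> R.

(* nabla p v Y is the covariant derivative at p, along v, of a vector field Y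
   that is smooth near p.  As a connection is local in Y, this is the same
   datum as a compatible family of operators on the smooth vector fields of
   the open subsets. *)
Definition connection (R : realType) (n : nat) (M : manifold R n) : Type :=
  forall p : M, 'rV[R]_n -> (M -> 'rV[R]_n) -> 'rV[R]_n.

Definition nondegenerate_on (R : realType) (n : nat) (M : manifold R n)
    (U : set M) (g : metric M) : Prop :=
  forall p v, U p -> (forall w, g p v w = 0) -> v = 0.

(* The structures below live on an open subset U of M. *)
Record pseudo_riemannian (R : realType) (n : nat) (M : manifold R n)
    (U : set M) (g : metric M) : Prop := {
  metric_linear : forall p a v w z, U p ->
    g p (a *: v + w) z = a * g p v z + g p w z;
  metric_sym : forall p v w, U p -> g p v w = g p w v;
  metric_nondegenerate : nondegenerate_on U g;
  metric_smooth : forall (W : set M) X Y, open W -> W `<=` U ->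
    smooth_field W X -> smooth_field W Y ->
    smooth_fun W (fun q => g q (X q) (Y q))
}.

Record affine_connection (R : realType) (n : nat) (M : manifold R n)
    (U : set M) (nabla : connection M) : Prop := {
  conn_local : forall p v Y Y', U p -> smooth_field_near p Y ->
    (\forall q \near p, Y q = Y' q) -> nabla p v Y = nabla p v Y';
  conn_linear : forall p a v w Y, U p -> smooth_field_near p Y ->
    nabla p (a *: v + w) Y = a *: nabla p v Y + nabla p w Y;
  conn_add : forall p v Y Z, U p ->
    smooth_field_near p Y -> smooth_field_near p Z ->
    nabla p v (fun q => Y q + Z q) = nabla p v Y + nabla p v Z;
  conn_leibniz : forall p v (u : M -> R) Y, U p ->
    smooth_fun_near p u -> smooth_field_near p Y ->
    nabla p v (fun q => u q *: Y q) =
      mderiv u p v *: Y p + u p *: nabla p v Y;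
  conn_smooth : forall (W : set M) X Y, open W -> W `<=` U ->
    smooth_field W X -> smooth_field W Y ->
    smooth_field W (fun q => nabla q (X q) Y);
  conn_torsion_free : forall p X Y, U p ->
    smooth_field_near p X -> smooth_field_near p Y ->
    nabla p (X p) Y - nabla p (Y p) X = lie_bracket X Y p
}.

(* (nabla_X g)(Y, Z) at p *)
Definition cov_metric (R : realType) (n : nat) (M : manifold R n)
    (nabla : connection M) (g : metric M) (X Y Z : M -> 'rV[R]_n) (p : M) : R :=
  mderiv (fun q => g q (Y q) (Z q)) p (X p)
    - g p (nabla p (X p) Y) (Z p) - g p (Y p) (nabla p (X p) Z).

Record statistical (R : realType) (n : nat) (M : manifold R n)
    (U : set M) (nabla : connection M) (g : metric M) : Prop := {
  stat_metric : pseudo_riemannian U g;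
  stat_connection : affine_connection U nabla;
  stat_symmetric : forall p X Y Z, U p -> smooth_field_near p X ->
    smooth_field_near p Y -> smooth_field_near p Z ->
    cov_metric nabla g X Y Z p = cov_metric nabla g Y X Z p /\
    cov_metric nabla g X Y Z p = cov_metric nabla g X Z Y p
}.

Definition curvature (R : realType) (n : nat) (M : manifold R n)
    (nabla : connection M) (X Y Z : M -> 'rV[R]_n) (p : M) : 'rV[R]_n :=
  nabla p (X p) (fun q => nabla q (Y q) Z)
    - nabla p (Y p) (fun q => nabla q (X q) Z)
    - nabla p (lie_bracket X Y p) Z.

Definition flat_on (R : realType) (n : nat) (M : manifold R n)
    (U : set M) (nabla : connection M) : Prop :=
  forall p X Y Z, U p -> smooth_field_near p X -> smooth_field_near p Y ->
    smooth_field_near p Z -> curvature nabla X Y Z p = 0.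

Definition dual_connections (R : realType) (n : nat) (M : manifold R n)
    (nabla nabla' : connection M) (g : metric M) : Prop :=
  forall p X Y Z, smooth_field_near p X ->
    smooth_field_near p Y -> smooth_field_near p Z ->
    mderiv (fun q => g q (Y q) (Z q)) p (X p) =
      g p (nabla p (X p) Y) (Z p) + g p (Y p) (nabla' p (X p) Z).

(* Flatness of nabla' is a consequence. *)
Definition dually_flat (R : realType) (n : nat) (M : manifold R n)
    (nabla nabla' : connection M) (g : metric M) : Prop :=
  [/\ statistical [set: M] nabla g, flat_on [set: M] nabla,
      affine_connection [set: M] nabla' & dual_connections nabla nabla' g].

Definition conf_proj_equivalent_on (R : realType) (n : nat)
    (M : manifold R n) (U : set M) (nabla : connection M) (g : metric M)
    (nabla' : connection M) (g' : metric M) : Prop :=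
  exists phi psi : M -> R,
  [/\ smooth_fun U phi /\ smooth_fun U psi,
      forall p, U p -> 0 < phi p /\ 0 < psi p,
      forall p v w, U p -> g' p v w = phi p * psi p * g p v w
    & forall p X Y Z, U p -> smooth_field_near p X ->
        smooth_field_near p Y -> smooth_field_near p Z ->
        g p (nabla' p (X p) Y) (Z p) =
          g p (nabla p (X p) Y) (Z p)
          - mderiv (fun q => ln (phi q)) p (Z p) * g p (X p) (Y p)
          + mderiv (fun q => ln (psi q)) p (X p) * g p (Y p) (Z p)
          + mderiv (fun q => ln (psi q)) p (Y p) * g p (X p) (Z p)].

Definition conf_proj_flat (R : realType) (n : nat) (M : manifold R n)
    (nabla : connection M) (g : metric M) : Prop :=
  statistical [set: M] nabla g /\
  forall p0 : M, exists (U : set M) (nabla' : connection M) (g' : metric M),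
    [/\ open U, U p0, statistical U nabla' g', flat_on U nabla'
      & conf_proj_equivalent_on U nabla g nabla' g'].

(* A global chart in which the Christoffel symbols of nabla vanish. *)
Definition affine_coordinates (R : realType) (m : nat) (N : manifold R m)
    (nabla : connection N) (theta : chart R m N) : Prop :=
  [/\ atlas theta, cdom theta = [set: N]
    & forall p i j,
        nabla p (coord_field theta i p) (coord_field theta j) = 0].

Definition radial (R : realType) (m : nat) (N : manifold R m)
    (theta : chart R m N) (p : N) : 'rV[R]_m :=
  \sum_(i < m) theta p 0 i *: coord_field theta i p.

(* Covariant derivative, along v tangent to M at p, of the vector field
   W = w^i (d/dc^i o f) along f : M -> N, in a chart c of N around f p:
   v(w^i) d/dc^i + w^i nabla_(f_* v) (d/dc^i).  The result does not depend on
   c. *)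
Definition along_derivative (R : realType) (n m : nat) (M : manifold R n)
    (N : manifold R m) (nabla : connection N) (c : chart R m N) (f : M -> N)
    (p : M) (v : 'rV[R]_n) (W : M -> 'rV[R]_m) : 'rV[R]_m :=
  let w (q : M) := mderiv c (f q) (W q) in
  \sum_(i < m) (mderiv (fun q => w q 0 i : R) p v *: coord_field c i (f p)
    + w p 0 i *: nabla (f p) (pushforward f p v) (coord_field c i)).

Definition immersion (R : realType) (n m : nat) (M : manifold R n)
    (N : manifold R m) (f : M -> N) : Prop :=
  smooth_map f /\ forall p, injective (pushforward f p).

Definition unit_normal_along (R : realType) (n m : nat) (M : manifold R n)
    (N : manifold R m) (g : metric N) (f : M -> N) (xi : M -> 'rV[R]_m) :
    Prop :=
  [/\ smooth_along f xi, forall p, g (f p) (xi p) (xi p) = 1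
    & forall p v, g (f p) (xi p) (pushforward f p v) = 0].

Definition centro_affine_immersion (R : realType) (n : nat)
    (M : manifold R n) (N : manifold R n.+2) (g : metric N)
    (theta : chart R n.+2 N) (f : M -> N) (xi : M -> 'rV[R]_n.+2) : Prop :=
  [/\ immersion f, unit_normal_along g f xi
    & forall p (w : 'rV[R]_n.+2), exists (v : 'rV[R]_n) (a b : R),
        w = pushforward f p v + a *: xi p + b *: radial theta (f p)].

Definition gauss_formula (R : realType) (n : nat) (M : manifold R n)
    (N : manifold R n.+2) (nablaN : connection N) (theta : chart R n.+2 N)
    (f : M -> N) (xi : M -> 'rV[R]_n.+2) (nabla : connection M)
    (h T : M -> 'rV[R]_n -> 'rV[R]_n -> R) : Prop :=
  forall p X Y, smooth_field_near p X -> smooth_field_near p Y ->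
    along_derivative nablaN theta f p (X p) (fun q => pushforward f q (Y q)) =
      pushforward f p (nabla p (X p) Y) + h p (X p) (Y p) *: xi p
      + T p (X p) (Y p) *: radial theta (f p).

Definition weingarten_formula (R : realType) (n : nat) (M : manifold R n)
    (N : manifold R n.+2) (nablaN : connection N) (theta : chart R n.+2 N)
    (f : M -> N) (xi : M -> 'rV[R]_n.+2) (S : M -> 'rV[R]_n -> 'rV[R]_n)
    (tau sigma : M -> 'rV[R]_n -> R) : Prop :=
  forall p v,
    along_derivative nablaN theta f p v xi =
      - pushforward f p (S p v) + tau p v *: xi p
      + sigma p v *: radial theta (f p).

(* Main.v *)
From HB Require Import structures.
Require Import Defs.
From mathcomp Require Import all_boot all_order all_algebra.
From mathcomp Require Import all_classical all_reals all_analysis.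
From mathcomp Require Import ring lra.
Set Implicit Arguments.
Unset Strict Implicit.
Unset Printing Implicit Defensive.
Import Order.TTheory GRing.Theory Num.Theory.
Import numFieldNormedType.Exports.
Local Open Scope classical_set_scope.
Local Open Scope ring_scope.

(** In the flat coordinates of the ambient space the immersion becomes a map
    x : M -> R^(n+2), the radial field along it becomes x itself, and the
    covariant derivative along it becomes the directional derivative D of
    R^(n+2)-valued functions.  If Xi denotes the components of the normal field,
    the Gauss and the equiaffine Weingarten formulae read
      D_X dx(Y) = dx(nabla_X Y) + h(X, Y) Xi + T(X, Y) x,
      D_X Xi = - dx(S X) + sigma(X) x.

    The proof rests on one principle, used twice.  Let F, A, B be maps from M to
    R^(n+2) such that dF(T_q M), A(q), B(q) span R^(n+2) at each point, such that
    D A and D B have no A-component, and such that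
      D_X dF(Y) = dF(nabla_X Y) + h(X, Y) A + T(X, Y) B.
    As the components of a vector along dF, A and B are unique, each rule for D
    splits into rules for nabla, h and T.  Linearity, additivity and the product
    rule make nabla a connection.  The operator D_X D_Y - D_Y D_X - D_[X,Y]
    vanishes; applied to F it shows that nabla has no torsion and that h is
    symmetric, and the A-component of its value on dF(Z) is the Codazzi equation.
    So (nabla, h) is a statistical structure as soon as h is non-degenerate
    ([gauss_statistical]).  If moreover A is constant and T = 0, the
    dF-component of the same equation says that the curvature of nabla vanishes
    ([gauss_flat]).

    With (F, A, B) = (x, Xi, x) the principle shows that (M, nabla, h) is a
    statistical manifold.  For the flat structure near a point p0, let
    b = Xi(p0), a constant vector, and let alpha be the linear form that is 1 on
    x(p0) and 0 on Xi(p0) and on the tangent vectors at p0.  Put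
    lam = alpha(x), and decompose b = dx(beta) + mu Xi + nu x.  Near p0 the
    functions lam and mu are positive; put psi = 1 / lam and phi = 1 / mu.  The
    central projection F = psi x maps M to the affine hyperplane alpha = 1, whose
    direction ker alpha is spanned by the tangent vectors of F and by b.  Hence
    D_X dF(Y), which lies in ker alpha, satisfies a Gauss formula with A = b
    constant and T = 0 ([conformal_gauss]), for the metric phi psi h and
      nabla'_X Y = nabla_X Y + dlog psi(X) Y + dlog psi(Y) X - h(X, Y) beta / mu,
    and the principle applies again.  Finally, differentiating the constant b
    yields d mu(v) = - h(v, beta) ([constant_decomposition]), so that beta / mu is
    the h-gradient of log phi, and nabla' is conformally-projectively equivalent
    to nabla with the functions phi and psi ([conformally_flat_near]). *)

(** * Differentiability and products with scalar functions *)

Section Calc.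
Context {R : realType}.

(** The difference of the two functions vanishes near [x], so it is a remainder
    of first order there. *)
Lemma differentiable_near_eq (V W : normedModType R) (f g : V -> W) x :
  (\near x, f x = g x) -> differentiable f x -> differentiable g x.
Proof.
move=> fg df; have -> : g = f + (g - f) by rewrite addrC subrK.
apply: differentiableD => //; set e := g - f.
have eo : e \o shift x = cst (e x) + (\0 : {linear V -> W}) +o_ 0 id.
  apply/eqaddoP => _ /posnumP[r]; near=> h.
  rewrite !fctE /= /e !fctE -(nbhs_singleton fg) subrr addr0 subr0.
  have -> : f (h + x) = g (h + x).
    near: h; rewrite !nbhs_simpl.
    have := fg; rewrite (near_shift 0 x).
    by apply: filterS => z; rewrite /= subr0.
  by rewrite subrr normr0 mulr_ge0.
apply/diff_locallyP.
have d0 : 'd e x = (\0 : {linear V -> W}) :> (V -> W).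
  by apply: diff_unique => //; exact: cst_continuous.
by rewrite d0; split => //; exact: cst_continuous.
Unshelve. all: by end_near. Qed.

Section Scale.
Variables (V W : normedModType R).

Lemma scale_is_bilinear :
  bilinear_for
    (GRing.Scale.Law.clone _ _ *:%R _) (GRing.Scale.Law.clone _ _ *:%R _)
    (@GRing.scale R W).
Proof.
split=> [u'|u] a x y /=.
- by rewrite scalerDl scalerA.
- by rewrite scalerDr !scalerA mulrC.
Qed.
HB.instance Definition _ := bilinear_isBilinear.Build R R W W _ _ (@GRing.scale R W)
  scale_is_bilinear.

(** Multiplication by scalars is a continuous bilinear map, so the product rule is
    the formula for the differential of such a map, composed with the pair of
    the two functions. *)
Lemma scale_fun_derive (k : V -> R) (f : V -> W) x :
  differentiable k x -> differentiable f x ->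
  differentiable (fun y => k y *: f y) x /\
  forall v, 'D_v (fun y => k y *: f y) x = 'D_v k x *: f x + k x *: 'D_v f x.
Proof.
move=> dk df.
have sc : continuous (fun p : R * W => p.1 *: p.2) by exact: scale_continuous.
have dp : differentiable (fun y => (k y, f y)) x by exact: differentiable_pair.
have db := @differentiable_bilin _ _ _ _ (@GRing.scale R W) (k x, f x) sc.
have dc : differentiable (fun y => k y *: f y) x by exact: (differentiable_comp dp db).
split=> // v; rewrite !deriveE //.
have -> : (fun y => k y *: f y) = (fun p : R * W => p.1 *: p.2) \o (fun y => (k y, f y)) by [].
rewrite diff_comp // (@diff_bilin _ _ _ _ (@GRing.scale R W)) //=.
by rewrite diff_pair //= addrC.
Qed.
End Scale.
End Calc.

(** * Maps of class C^k *)

Section Smooth.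
Context {R : realType}.
Section VW.
Variables (V W : normedModType R).
Implicit Types (U : set V) (F G : V -> W).

Lemma Ck_on_sub k U U' F : U' `<=` U -> Ck_on k U F -> Ck_on k U' F.
Proof.
move=> sU; elim: k F => [|k IH] F /=; first by move=> H x /sU/H.
by move=> [H1 H2]; split=> [x /sU/H1//|v]; exact/IH/H2.
Qed.

Lemma derive_eq_on U F G x v : open U -> U x -> (forall x, U x -> F x = G x) ->
  'D_v F x = 'D_v G x.
Proof.
move=> oU Ux FG; apply: near_eq_derive.
by apply: filterS (open_nbhs_nbhs (conj oU Ux)) => y; exact: FG.
Qed.

Lemma Ck_on_eq k U F G : open U -> (forall x, U x -> F x = G x) ->
  Ck_on k U F -> Ck_on k U G.
Proof.
move=> oU; elim: k F G => [|k IH] F G FG /=.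
  move=> H x Ux; rewrite /prop_for /continuous_at -(FG _ Ux).
  apply: cvg_trans (H _ Ux); apply: near_eq_cvg.
  by apply: filterS (open_nbhs_nbhs (conj oU Ux)) => y; exact: FG.
move=> [H1 H2]; split=> [x Ux|v].
  apply: differentiable_near_eq (H1 _ Ux).
  by apply: filterS (open_nbhs_nbhs (conj oU Ux)) => y; exact: FG.
by apply: IH (H2 v) => x Ux; apply: derive_eq_on Ux _.
Qed.

Lemma Ck_onW k U F : Ck_on k.+1 U F -> Ck_on k U F.
Proof.
elim: k F => [|k IH] F; first by move=> [H _] x /H; exact: differentiable_continuous.
by move=> [H1 H2]; split=> // v; exact/IH/H2.
Qed.

Lemma Ck_on_cst k U (a : W) : Ck_on k U (fun=> a).
Proof.
elim: k a => [|k IH] a /=; first by move=> x _; exact: cst_continuous.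
split=> [x _|v]; first exact: differentiable_cst.
suff -> : (fun x : V => 'D_v (fun=> a) x) = (fun=> 0) by exact: IH.
by apply/funext => x; exact: derive_cst.
Qed.

Lemma Ck_onD k U F G : open U -> Ck_on k U F -> Ck_on k U G ->
  Ck_on k U (fun x => F x + G x).
Proof.
move=> oU; elim: k F G => [|k IH] F G /=.
  by move=> H1 H2 x Ux; apply: continuousD; [exact: H1|exact: H2].
move=> [F1 F2] [G1 G2]; split=> [x Ux|v].
  by apply: differentiableD; [exact: F1|exact: G1].
apply: Ck_on_eq (IH _ _ (F2 v) (G2 v)) => // x Ux.
by rewrite deriveD //; apply: diff_derivable; [exact: F1|exact: G1].
Qed.

End VW.

Section VW.
Variables (V W : normedModType R).
Implicit Types (U : set V) (F G : V -> W).

Lemma Ck_onZ k U (f : V -> R) G : open U -> Ck_on k U f -> Ck_on k U G ->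
  Ck_on k U (fun x => f x *: G x).
Proof.
move=> oU; elim: k f G => [|k IH] f G.
  by move=> H1 H2 x Ux; apply: continuousZ; [exact: H1|exact: H2].
move=> cf cG; move: (cf) (cG) => [F1 F2] [G1 G2]; split=> [x Ux|v].
  by have [] := scale_fun_derive (F1 _ Ux) (G1 _ Ux).
apply: (@Ck_on_eq _ _ _ _ (fun x => 'D_v f x *: G x + f x *: 'D_v G x)) => //.
  by move=> x Ux; have [_ ->] := scale_fun_derive (F1 _ Ux) (G1 _ Ux).
by apply: Ck_onD => //; apply: IH; first [exact: F2 | exact: G2 | exact: Ck_onW].
Qed.

Lemma Ck_on_sum k U (I : Type) (r : seq I) (P : pred I) (F : I -> V -> W) :
  open U -> (forall i, P i -> Ck_on k U (F i)) ->
  Ck_on k U (fun x => \sum_(i <- r | P i) F i x).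
Proof.
move=> oU H; elim: r => [|i r IH].
  by apply: Ck_on_eq (Ck_on_cst k U 0) => // x _; rewrite big_nil.
have [Pi|nPi] := boolP (P i).
  by apply: Ck_on_eq (Ck_onD oU (H _ Pi) IH) => // x _; rewrite big_cons Pi.
by apply: Ck_on_eq IH => // x _; rewrite big_cons (negbTE nPi).
Qed.

Lemma Ck_on_linl k U F (W' : normedModType R) (L : {linear W -> W'}) :
  open U -> continuous L -> Ck_on k U F -> Ck_on k U (fun x => L (F x)).
Proof.
move=> oU cL; elim: k F => [|k IH] F /=.
  move=> H x Ux; apply: (@continuous_comp _ _ _ F L); [exact: H|exact: cL].
move=> [F1 F2]; split=> [x Ux|v].
  by apply: (@differentiable_comp _ _ _ _ F L); [exact: F1|exact: linear_differentiable].
apply: Ck_on_eq (IH _ (F2 v)) => // x Ux.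
have dL := @linear_differentiable _ _ _ L (F x) cL.
rewrite !deriveE ?(@diff_comp _ _ _ _ F L) ?diff_lin //; try exact: F1.
by apply: (@differentiable_comp _ _ _ _ F L) => //; exact: F1.
Qed.

Lemma Ck_on_lin k U (L : {linear V -> W}) : continuous L -> Ck_on k U L.
Proof.
move=> cL; case: k => [|k] /=; first by move=> x _; exact: cL.
split=> [x _|v]; first exact: linear_differentiable.
suff -> : (fun x : V => 'D_v L x) = (fun=> L v) by exact: Ck_on_cst.
by apply/funext => x; rewrite deriveE ?diff_lin //; exact: linear_differentiable.
Qed.
End VW.

Lemma Ck_onV (V : normedModType R) k (U : set V) (f : V -> R) : open U ->
  (forall x, U x -> f x != 0) -> Ck_on k U f -> Ck_on k U (fun x => (f x)^-1).
Proof.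
move=> oU f0; elim: k => [|k IH].
  by move=> H x Ux; apply: continuousV; [exact: f0|exact: H].
move=> cf; move: (cf) => [F1 F2]; split=> [x Ux|v].
  by apply: differentiableV; [exact: F1|exact: f0].
have fi := IH (Ck_onW cf).
apply: (@Ck_on_eq _ _ _ _ (fun x => -1 *: ((f x)^-1 *: ((f x)^-1 *: 'D_v f x)))) => //.
  move=> x Ux; rewrite (@deriveV _ _ f) ?f0 //; last exact/diff_derivable/F1.
  by rewrite scalerA scaleN1r -scaleNr -exprVn expr2.
apply: Ck_onZ => //; first exact: Ck_on_cst.
by apply: Ck_onZ => //; apply: Ck_onZ => //; exact: F2.
Qed.

(** Coordinates are packaged as linear maps, so that the closure of C^k maps under
    composition with continuous linear maps applies to them. *)
Definition coordl (m : nat) (i : 'I_m) (x : 'rV[R]_m) : R := x 0 i.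
Lemma coordl_is_linear m i : linear (@coordl m i).
Proof. by move=> a u v; rewrite /coordl !mxE. Qed.
HB.instance Definition _ m i :=
  GRing.isLinear.Build R 'rV[R]_m R _ (@coordl m i) (@coordl_is_linear m i).
Lemma coordl_continuous m i : continuous (@coordl m i).
Proof. exact: coord_continuous. Qed.

Section RV.
Variables (V W : normedModType R) (m : nat).
Implicit Types (U : set V) (F : V -> 'rV[R]_m).

Lemma Ck_on_coord k U F : open U ->
  Ck_on k U F <-> forall i, Ck_on k U (fun x => F x 0 i).
Proof.
move=> oU; split=> [H i|H]; first exact: (Ck_on_linl oU (@coordl_continuous m i) H).
apply: (@Ck_on_eq _ _ _ _ (fun x => \sum_i F x 0 i *: (delta_mx 0 i : 'rV[R]_m))) => //.
  by move=> x _; rewrite -row_sum_delta.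
by apply: Ck_on_sum => // i _; apply: Ck_onZ => //; exact: Ck_on_cst.
Qed.

Lemma derive_coord F x v i : differentiable F x ->
  'D_v (fun y => F y 0 i) x = ('D_v F x) 0 i.
Proof. by move=> dF; rewrite derive_mx ?mxE //; exact: diff_derivable. Qed.

Lemma derive_lin_sum (G : 'rV[R]_m -> W) x v : differentiable G x ->
  'D_v G x = \sum_i v 0 i *: 'D_(delta_mx 0 i) G x.
Proof.
move=> dG; rewrite deriveE // {1}(row_sum_delta v) linear_sum.
by apply: eq_bigr => i _; rewrite linearZ deriveE.
Qed.

Lemma derive_comp F (G : 'rV[R]_m -> W) x v : differentiable F x ->
  differentiable G (F x) -> 'D_v (G \o F) x = 'D_('D_v F x) G (F x).
Proof.
move=> dF dG; have dGF := differentiable_comp dF dG.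
by rewrite (deriveE v dGF) (deriveE v dF) (deriveE _ dG) (diff_comp dF dG).
Qed.

(** In the chain rule [G] is differentiated in a direction that varies with the
    point.  That derivative is expanded over the standard basis, which leaves
    derivatives of [G] in fixed directions, to which the induction hypothesis
    applies. *)
Lemma Ck_on_comp k U (U' : set 'rV[R]_m) F (G : 'rV[R]_m -> W) : open U ->
  (forall x, U x -> U' (F x)) -> Ck_on k U F -> Ck_on k U' G ->
  Ck_on k U (G \o F).
Proof.
move=> oU FU; elim: k G => [|k IH] G.
  by move=> H1 H2 x Ux; apply: continuous_comp; [exact: H1|exact/H2/FU].
move=> cF; move: (cF) => [F1 F2] [G1 G2]; split=> [x Ux|v].
  by apply: differentiable_comp; [exact: F1|exact/G1/FU].
apply: (@Ck_on_eq _ _ _ _ (fun x => \sum_i ('D_v F x) 0 i *: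
   ((fun z => 'D_(delta_mx 0 i) G z) \o F) x)) => //.
  move=> x Ux; rewrite derive_comp ?derive_lin_sum //; try exact: F1; exact/G1/FU.
apply: Ck_on_sum => // i _; apply: Ck_onZ => //.
  exact: ((Ck_on_coord _ _ oU).1 (F2 v) i).
by apply: IH; first [exact: G2 | exact: Ck_onW].
Qed.
End RV.
End Smooth.

(** * Symmetry of second derivatives *)

Section Schwarz.
Context {R : realType}.
Variables (V : normedModType R).
Implicit Types (F : V -> R).

Lemma is_derive_line F (y v : V) (s : R) : differentiable F (y + s *: v) ->
  is_derive s 1 (fun r => F (y + r *: v)) ('D_v F (y + s *: v)).
Proof.
move=> dF.
have [da dav] : is_diff s (fun r : R => y + r *: v) (0 + ( *:%R ^~ v)).
  exact: (is_diffD (is_diff_cst y s) (is_diff_scalel s v)).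
have dFa : differentiable (F \o (fun r : R => y + r *: v)) s.
  exact: differentiable_comp.
apply: DeriveDef; first exact: diff_derivable.
rewrite (deriveE _ dFa) diff_comp //.
by rewrite (deriveE _ dF) /= dav !fctE /= add0r scale1r.
Qed.

Lemma MVT_line F (y v : V) (t : R) : 0 < t ->
  (forall s, 0 <= s <= t -> differentiable F (y + s *: v)) ->
  exists2 s, 0 <= s <= t & F (y + t *: v) - F y = t * 'D_v F (y + s *: v).
Proof.
move=> t0 dF.
have [|||s] := @MVT R (fun r => F (y + r *: v)) (fun s => 'D_v F (y + s *: v)) 0 t => //.
- move=> s; rewrite in_itv /= => /andP[s0 st]; apply: is_derive_line.
  by apply: dF; rewrite !ltW.
- apply: continuous_in_subspaceT => s; rewrite inE /= in_itv /= => st.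
  apply/differentiable_continuous/derivable1_diffP.
  by have [] := is_derive_line (dF _ st).
rewrite in_itv /= => /andP[s0 st]; rewrite scale0r addr0 subr0 mulrC => H.
by exists s; rewrite // !ltW.
Qed.

Lemma derive_shift_pt F (z u v : V) : differentiable F (z + u) ->
  differentiable (fun y => F (y + u)) z /\
  'D_v (fun y => F (y + u)) z = 'D_v F (z + u).
Proof.
move=> dF; have [da dav] : is_diff z (fun y : V => y + u) (id + 0).
  exact: (is_diffD (is_diff_id z) (is_diff_cst u z)).
have dFa : differentiable (F \o (fun y => y + u)) z.
  exact: differentiable_comp.
split=> //; rewrite (deriveE _ dFa) diff_comp //.
by rewrite (deriveE _ dF) /= dav !fctE addr0.
Qed.

(** The mean value theorem is applied first, in the direction [v], to the increment
    of [F] along [t *: w], then to ['D_v F] in the direction [w]. *)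
Lemma second_difference F (x v w : V) (t : R) : 0 < t ->
  (forall s r, 0 <= s <= t -> 0 <= r <= t ->
    differentiable F (x + s *: v + r *: w) /\
    differentiable (fun z => 'D_v F z) (x + s *: v + r *: w)) ->
  exists s r, [/\ 0 <= s <= t, 0 <= r <= t &
    F (x + t *: v + t *: w) - F (x + t *: v) - (F (x + t *: w) - F x) =
    t * (t * 'D_w (fun z => 'D_v F z) (x + s *: v + r *: w))].
Proof.
move=> t0 dF.
have t00 : (0 : R) <= 0 <= t by rewrite lexx ltW.
have tt : 0 <= t <= t by rewrite lexx andbT ltW.
pose G z := F (z + t *: w) - F z.
have dG s : 0 <= s <= t -> differentiable G (x + s *: v) /\
   'D_v G (x + s *: v) = 'D_v F (x + s *: v + t *: w) - 'D_v F (x + s *: v).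
  move=> st; have [/derive_shift_pt-/(_ v)[d1 e1] _] := dF s t st tt.
  have [d2 _] := dF s 0 st t00; rewrite scale0r addr0 in d2.
  split; first exact: differentiableB.
  by rewrite /G deriveB ?e1 //; exact: diff_derivable.
have [s st] := @MVT_line G x v t t0 (fun s st => (dG s st).1).
rewrite (dG s st).2.
have [r rt ->] := @MVT_line (fun z => 'D_v F z) (x + s *: v) w t t0
  (fun r rt => (dF s r st rt).2).
by move=> H; exists s, r; split.
Qed.

Lemma near_parallelogram (x v w : V) (P : set V) : nbhs x P ->
  exists2 t : R, 0 < t & forall s r, 0 <= s <= t -> 0 <= r <= t ->
    P (x + s *: v + r *: w).
Proof.
move=> /nbhs_normP[e /= e0 eP].
have N0 : 0 < 1 + `|v| + `|w|.
  by rewrite -addrA ltr_wpDr ?addr_ge0 ?normr_ge0.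
(* Half of e, because the estimate below is not strict; 1, because v and w may
   vanish. *)
exists (e / 2 / (1 + `|v| + `|w|)); first by rewrite !divr_gt0.
move=> s r /andP[s0 st] /andP[r0 rt]; apply: eP => /=.
rewrite -addrA opprD addrA subrr add0r normrN.
apply: (le_lt_trans (ler_normD _ _)); rewrite !normrZ !ger0_norm //.
apply: (@le_lt_trans _ _ (e / 2)).
  apply: (@le_trans _ _ (e / 2 / (1 + `|v| + `|w|) * (`|v| + `|w|))).
    by rewrite mulrDr lerD // ler_wpM2r.
  by rewrite mulrAC ler_pdivrMr // ler_wpM2l ?divr_ge0 ?(ltW e0) // -addrA lerDr.
by rewrite ltr_pdivrMr // ltr_pMr // ltr1n.
Qed.

(** The second difference over a parallelogram with sides [t *: v] and [t *: w] is
    [t * t] times either mixed derivative, each evaluated at some point of the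
    parallelogram.  Both are continuous, so they agree in the limit of small
    [t]. *)
Lemma schwarz (U : set V) F (x v w : V) : open U -> Ck_on 2 U F -> U x ->
  'D_v (fun z => 'D_w F z) x = 'D_w (fun z => 'D_v F z) x.
Proof.
move=> oU [dF d2F] Ux.
apply/eqP; rewrite eq_le.
suff H v' w' : 'D_v' (fun z => 'D_w' F z) x <= 'D_w' (fun z => 'D_v' F z) x.
  by apply/andP; split; exact: H.
move: v' w' => {}v {}w; apply/ler_addgt0Pr => e e0; have e2 : 0 < e / 2 by rewrite divr_gt0.
have [_ /(_ v) cA] := d2F w; have [_ /(_ w) cB] := d2F v.
have [t t0 tP] := @near_parallelogram x v w _
  (filterI (open_nbhs_nbhs (conj oU Ux)) (filterI
    ((cvgrPdist_lt _ _).1 (cA x Ux) _ e2) ((cvgrPdist_lt _ _).1 (cB x Ux) _ e2))).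
have [|s [r [st rt E1]]] := @second_difference F x v w t t0.
  move=> s r st rt; have [Usr _] := tP s r st rt; split; first exact: dF.
  by have [+ _] := d2F v; exact.
have [|s' [r' [st' rt' E2]]] := @second_difference F x w v t t0.
  move=> s1 r1 st' rt'; have [Usr _] := tP r1 s1 rt' st'; rewrite addrAC.
  split; first exact: dF.
  by have [+ _] := d2F w; exact.
have E : 'D_w (fun z => 'D_v F z) (x + s *: v + r *: w) =
         'D_v (fun z => 'D_w F z) (x + s' *: w + r' *: v).
  apply: (mulfI (lt0r_neq0 t0)); apply: (mulfI (lt0r_neq0 t0)).
  rewrite -E1 -E2 (addrAC x (t *: w)).
  have swap (a b c d : R) : a - b - (c - d) = a - c - (b - d) by ring.
  exact: swap.
have [_ [_ /= h1]] := tP s r st rt.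
have [_ [/= h2 _]] := tP r' s' rt' st'.
rewrite (addrAC x) -E in h2.
have close (a b c : R) : `|b - c| < e / 2 -> `|a - c| < e / 2 -> a <= b + e.
  rewrite !ltr_norml; clear; lra.
exact: close h1 h2.
Qed.
End Schwarz.

(** * Smooth maps on open sets *)

Section SmoothOn.
Context {R : realType}.

Section VW.
Variables (V W : normedModType R) (U : set V).
Hypothesis oU : open U.
Implicit Types (F G : V -> W).

Lemma smooth_on_sub U' F : U' `<=` U -> smooth_on U F -> smooth_on U' F.
Proof. by move=> sU sF k; exact: Ck_on_sub sU (sF k). Qed.

Lemma smooth_on_eq F G : (forall x, U x -> F x = G x) ->
  smooth_on U F -> smooth_on U G.
Proof. by move=> FG sF k; exact: Ck_on_eq FG (sF k). Qed.

Lemma smooth_on_differentiable F x : smooth_on U F -> U x -> differentiable F x.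
Proof. by move=> /(_ 1%N)[+ _]; exact. Qed.

Lemma smooth_on_continuous F x : smooth_on U F -> U x -> {for x, continuous F}.
Proof. by move=> /(_ 0%N); exact. Qed.

Lemma smooth_on_derive F v : smooth_on U F -> smooth_on U (fun x => 'D_v F x).
Proof. by move=> sF k; have [_] := sF k.+1; exact. Qed.

Lemma smooth_on_cst (a : W) : smooth_on U (fun=> a).
Proof. by move=> k; exact: Ck_on_cst. Qed.

Lemma smooth_onD F G : smooth_on U F -> smooth_on U G ->
  smooth_on U (fun x => F x + G x).
Proof. by move=> sF sG k; exact: Ck_onD (sF k) (sG k). Qed.

Lemma smooth_onZ (f : V -> R) G : smooth_on U f -> smooth_on U G ->
  smooth_on U (fun x => f x *: G x).
Proof. by move=> sF sG k; exact: Ck_onZ (sF k) (sG k). Qed.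

Lemma smooth_on_sum (I : Type) (r : seq I) (P : pred I) (F : I -> V -> W) :
  (forall i, P i -> smooth_on U (F i)) ->
  smooth_on U (fun x => \sum_(i <- r | P i) F i x).
Proof. by move=> sF k; apply: Ck_on_sum => // i /sF; exact. Qed.

End VW.

Section Scalar.
Variables (V : normedModType R) (U : set V).
Hypothesis oU : open U.

Lemma smooth_onM (f g : V -> R) : smooth_on U f -> smooth_on U g ->
  smooth_on U (fun x => f x * g x).
Proof. exact: smooth_onZ. Qed.

Lemma smooth_onV (f : V -> R) : (forall x, U x -> f x != 0) ->
  smooth_on U f -> smooth_on U (fun x => (f x)^-1).
Proof. by move=> f0 sf k; apply: Ck_onV. Qed.

Lemma smooth_on_prod (I : Type) (r : seq I) (P : pred I) (f : I -> V -> R) :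
  (forall i, P i -> smooth_on U (f i)) ->
  smooth_on U (fun x => \prod_(i <- r | P i) f i x).
Proof.
move=> H; elim: r => [|i r IH].
  by apply: (smooth_on_eq oU _ (smooth_on_cst U (1 : R))) => // x _; rewrite big_nil.
have [Pi|nPi] := boolP (P i).
  by apply: (smooth_on_eq oU _ (smooth_onM (H _ Pi) IH)) => x _; rewrite big_cons Pi.
by apply: (smooth_on_eq oU _ IH) => x _; rewrite big_cons (negbTE nPi).
Qed.

Lemma smooth_on_det n (A : V -> 'M[R]_n) :
  (forall i j, smooth_on U (fun x => A x i j)) ->
  smooth_on U (fun x => \det (A x)).
Proof.
move=> sA; apply: smooth_on_sum => // s _; apply: smooth_onM.
  exact: smooth_on_cst.
by apply: smooth_on_prod.
Qed.

(** By Cramer's formula. *)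
Lemma smooth_on_invmx n (A : V -> 'M[R]_n) :
  (forall x, U x -> A x \in unitmx) ->
  (forall i j, smooth_on U (fun x => A x i j)) ->
  forall i j, smooth_on U (fun x => invmx (A x) i j).
Proof.
move=> uA sA i j.
apply: (@smooth_on_eq _ _ _ oU (fun x => (\det (A x))^-1 * \adj (A x) i j)).
  by move=> x Ux; rewrite /invmx uA // [RHS]mxE.
apply: smooth_onM.
  apply: smooth_onV; last exact: (smooth_on_det sA).
  by move=> x /uA; rewrite unitmxE unitfE.
apply: (@smooth_on_eq _ _ _ oU
  (fun x => (-1) ^+ (j + i) * \det (row' j (col' i (A x))))).
  by move=> x _; rewrite mxE.
apply: smooth_onM; first exact: smooth_on_cst.
apply: smooth_on_det => k l.
apply: (@smooth_on_eq _ _ _ oU (fun x => A x (lift j k) (lift i l))) => //.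
by move=> x _; rewrite !mxE.
Qed.
End Scalar.

Section RV.
Variables (V W : normedModType R) (m : nat) (U : set V).
Hypothesis oU : open U.
Implicit Types (F : V -> 'rV[R]_m).

Lemma smooth_on_coord F :
  smooth_on U F <-> forall i, smooth_on U (fun x => F x 0 i).
Proof.
split=> [sF i k|sF k]; first exact: ((Ck_on_coord k F oU).1 (sF k)).
by apply/(Ck_on_coord k F oU) => i; exact: sF.
Qed.

Lemma smooth_on_comp (U' : set 'rV[R]_m) F (G : 'rV[R]_m -> W) :
  (forall x, U x -> U' (F x)) -> smooth_on U F -> smooth_on U' G ->
  smooth_on U (G \o F).
Proof. by move=> FU sF sG k; exact: Ck_on_comp FU (sF k) (sG k). Qed.
End RV.

Lemma smooth_on_derive_dir (W : normedModType R) m (U : set 'rV[R]_m)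
    (eta : 'rV[R]_m -> 'rV[R]_m) (G : 'rV[R]_m -> W) : open U ->
  smooth_on U eta -> smooth_on U G ->
  smooth_on U (fun z => 'D_(eta z) G z).
Proof.
move=> oU seta sG.
apply: (@smooth_on_eq _ _ _ oU
   (fun z => \sum_i eta z 0 i *: 'D_(delta_mx 0 i) G z)).
  by move=> z Uz; rewrite -derive_lin_sum //; exact: smooth_on_differentiable Uz.
apply: smooth_on_sum => // i _; apply: smooth_onZ => //.
  exact: ((smooth_on_coord oU eta).1 seta).
exact: smooth_on_derive.
Qed.

(** The product rule for the sum of the [eta z 0 i *: 'D_(delta_mx 0 i) G z]: a
    term where the direction is differentiated, and one where it is frozen. *)
Lemma derive_dir_derive m (U : set 'rV[R]_m) (eta : 'rV[R]_m -> 'rV[R]_m)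
    (G : 'rV[R]_m -> R) x v : open U -> U x ->
  smooth_on U eta -> smooth_on U G ->
  'D_v (fun z => 'D_(eta z) G z) x =
    'D_('D_v eta x) G x + 'D_v (fun z => 'D_(eta x) G z) x.
Proof.
move=> oU Ux seta sG.
have dG i z : U z -> differentiable (fun y => 'D_(delta_mx 0 i) G y) z.
  by apply: smooth_on_differentiable; exact: smooth_on_derive.
have de i z : U z -> differentiable (fun y => eta y 0 i) z.
  by apply: smooth_on_differentiable; exact: ((smooth_on_coord oU eta).1 seta).
have -> : 'D_v (fun z => 'D_(eta z) G z) x =
   'D_v (\sum_i (fun z => eta z 0 i *: 'D_(delta_mx 0 i) G z)) x.
  apply: derive_eq_on oU Ux _ => z Uz; rewrite fct_sumE.
  by rewrite -derive_lin_sum //; exact: smooth_on_differentiable Uz.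
have -> : 'D_v (fun z => 'D_(eta x) G z) x =
   'D_v (\sum_i (fun z => eta x 0 i *: 'D_(delta_mx 0 i) G z)) x.
  apply: derive_eq_on oU Ux _ => z Uz; rewrite fct_sumE.
  by rewrite -derive_lin_sum //; exact: smooth_on_differentiable Uz.
rewrite derive_sum; last first.
  move=> i; apply/diff_derivable.
  by have [] := scale_fun_derive (de i x Ux) (dG i x Ux).
rewrite derive_sum; last first.
  by move=> i; apply/diff_derivable; apply: differentiableZ; exact: dG.
rewrite (derive_lin_sum _ (smooth_on_differentiable sG Ux)) -big_split /=.
apply: eq_bigr => i _; have [_ ->] := scale_fun_derive (de i x Ux) (dG i x Ux).
rewrite derive_coord; last exact: smooth_on_differentiable Ux.
by congr (_ + _); rewrite deriveZ //; exact/diff_derivable/dG.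
Qed.
End SmoothOn.

(** * Charts and derivatives on a manifold *)

Section Manifold.
Context {R : realType} {n : nat} {M : manifold R n}.
Implicit Types (c d : chart R n M) (p q : M) (U : set M).

Lemma chart_img_nbhs c q : cdom c q -> nbhs (c q) (c @` cdom c).
Proof. by move=> cq; apply: open_nbhs_nbhs; split; [exact: cimg_open|exists q]. Qed.

Lemma cinv_nbhs c q (P : set M) : cdom c q -> nbhs q P ->
  nbhs (c q) (fun z => P (cinv c z)).
Proof.
move=> cq Pq; have cc : {for c q, continuous (cinv c)} by apply: cinv_continuous; exists q.
by move: (cc P); rewrite /= cmapK //; exact.
Qed.

Lemma chart_nbhs c q (P : set 'rV[R]_n) : cdom c q -> nbhs (c q) P ->
  nbhs q (fun q => P (c q)).
Proof. by move=> cq; exact: (cmap_continuous cq). Qed.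

Lemma cdom_nbhs c q : cdom c q -> nbhs q (cdom c).
Proof. by move=> cq; apply: open_nbhs_nbhs; split=> //; exact: cdom_open. Qed.

Lemma open_chart_img c U : open U -> open (c @` (U `&` cdom c)).
Proof.
move=> oU; rewrite openE => _ [q [Uq cq] <-]; rewrite /interior.
apply: filterS (filterI (chart_img_nbhs cq)
  (cinv_nbhs cq (open_nbhs_nbhs (conj oU Uq)))) => z [[r cr <-]].
by rewrite cmapK // => Ur; exists r.
Qed.

Arguments open_chart_img c [U] _.

Lemma transition_smooth c d : atlas c -> atlas d ->
  smooth_on (c @` (cdom c `&` cdom d)) (d \o cinv c).
Proof. by move=> ac ad; have [] := atlas_compatible ac ad. Qed.

Lemma transition_differentiable c d q : atlas c -> atlas d -> cdom c q ->
  cdom d q -> differentiable (d \o cinv c) (c q).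
Proof.
move=> ac ad cq dq; apply: (smooth_on_differentiable (transition_smooth ac ad)).
by exists q.
Qed.

Section Functions.
Variable W : normedModType R.
Implicit Types (F G : M -> W).

Lemma smooth_fun_differentiable U F c p : smooth_fun U F -> U p -> atlas c ->
  cdom c p -> differentiable (F \o cinv c) (c p).
Proof.
move=> sF Up ac cp; apply: (smooth_on_differentiable (sF _ ac)).
by exists p.
Qed.

Definition mdifferentiable F p :=
  differentiable (F \o cinv (chart_at p)) (chart_at p p).

Lemma smooth_fun_mdiff U F p : smooth_fun U F -> U p -> mdifferentiable F p.
Proof.
move=> sF Up; apply: smooth_fun_differentiable Up _ _ => //.
  exact: chart_at_atlas.
exact: chart_at_dom.
Qed.

Lemma mderiv_near F G p v : (\forall q \near p, F q = G q) ->
  mderiv F p v = mderiv G p v.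
Proof.
by move=> FG; apply: near_eq_derive; apply: cinv_nbhs FG; exact: chart_at_dom.
Qed.

Lemma mderiv_eq_on U F G p v : open U -> U p -> (forall q, U q -> F q = G q) ->
  mderiv F p v = mderiv G p v.
Proof.
move=> oU Up FG; apply: mderiv_near.
by apply: filterS (open_nbhs_nbhs (conj oU Up)) => y; exact: FG.
Qed.

(** The chain rule for a change of coordinates; every passage between charts below
    comes from it. *)
Lemma derive_chart_change F c d q v : atlas c -> atlas d -> cdom c q ->
  cdom d q -> differentiable (F \o cinv d) (d q) ->
  'D_('D_v (d \o cinv c) (c q)) (F \o cinv d) (d q) = 'D_v (F \o cinv c) (c q).
Proof.
move=> ac ad cq dq dF.
have <- : 'D_v ((F \o cinv d) \o (d \o cinv c)) (c q) = 'D_v (F \o cinv c) (c q).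
  apply: near_eq_derive; have := cinv_nbhs cq (cdom_nbhs dq).
  by apply: filterS => z dz /=; rewrite cmapK.
have dq' : d q = (d \o cinv c) (c q) by rewrite /= cmapK.
rewrite derive_comp -?dq' //; exact: transition_differentiable.
Qed.

Lemma mderiv_chart F c p v : atlas c -> cdom c p ->
  differentiable (F \o cinv c) (c p) ->
  mderiv F p v = 'D_(mderiv c p v) (F \o cinv c) (c p).
Proof.
move=> ac cp dF; rewrite derive_chart_change //.
  exact: chart_at_atlas.
exact: chart_at_dom.
Qed.

Lemma mderiv_linear F p a v w : mdifferentiable F p ->
  mderiv F p (a *: v + w) = a *: mderiv F p v + mderiv F p w.
Proof. by move=> dF; rewrite /mderiv !deriveE // linearP. Qed.

Lemma mderiv0v F p : mdifferentiable F p -> mderiv F p 0 = 0.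
Proof. by move=> dF; rewrite /mderiv deriveE // linear0. Qed.

Lemma mderivDv F p v w : mdifferentiable F p ->
  mderiv F p (v + w) = mderiv F p v + mderiv F p w.
Proof. by move=> dF; rewrite /mderiv !deriveE // linearD. Qed.

Lemma mderivZv F p a v : mdifferentiable F p ->
  mderiv F p (a *: v) = a *: mderiv F p v.
Proof. by move=> dF; rewrite /mderiv !deriveE // linearZ. Qed.

Lemma mderivBv F p v w : mdifferentiable F p ->
  mderiv F p (v - w) = mderiv F p v - mderiv F p w.
Proof. by move=> dF; rewrite /mderiv !deriveE // linearB. Qed.

Lemma mderiv_cst (a : W) p v : mderiv (fun=> a : W) p v = 0.
Proof. exact: derive_cst. Qed.

Lemma mderivD F G p v : mdifferentiable F p -> mdifferentiable G p ->
  mderiv (fun q => F q + G q) p v = mderiv F p v + mderiv G p v.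
Proof. by move=> dF dG; rewrite /mderiv -deriveD //; exact: diff_derivable. Qed.

End Functions.

Section Functions.
Variable W : normedModType R.
Implicit Types (F G : M -> W).

Lemma mderivZ (f : M -> R) G p v : mdifferentiable (f : M -> R) p ->
  mdifferentiable G p ->
  mderiv (fun q => f q *: G q) p v = mderiv f p v *: G p + f p *: mderiv G p v.
Proof.
move=> df dG; have [_ E] := scale_fun_derive df dG.
apply: etrans (E v) _; rewrite /= cmapK //; exact: chart_at_dom.
Qed.

Lemma smooth_fun_sub U U' F : U' `<=` U -> smooth_fun U F -> smooth_fun U' F.
Proof.
move=> sU sF c ac; apply: smooth_on_sub (sF c ac).
by move=> _ [q [Uq cq] <-]; exists q => //; split=> //; exact: sU.
Qed.

Lemma smooth_fun_eq U F G : open U -> (forall q, U q -> F q = G q) ->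
  smooth_fun U F -> smooth_fun U G.
Proof.
move=> oU FG sF c ac; apply: smooth_on_eq (sF c ac); first exact: open_chart_img.
by move=> _ [q [Uq cq] <-] /=; rewrite cmapK //; exact: FG.
Qed.

Lemma smooth_fun_cst U (a : W) : smooth_fun U (fun=> a).
Proof. by move=> c ac; exact: smooth_on_cst. Qed.

Lemma smooth_funD U F G : open U -> smooth_fun U F -> smooth_fun U G ->
  smooth_fun U (fun q => F q + G q).
Proof.
move=> oU sF sG c ac.
exact: (smooth_onD (open_chart_img c oU) (sF c ac) (sG c ac)).
Qed.

End Functions.

Section Functions.
Variable W : normedModType R.
Implicit Types (F G : M -> W).

Lemma smooth_funZ U (f : M -> R) G : open U -> smooth_fun U f ->
  smooth_fun U G -> smooth_fun U (fun q => f q *: G q).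
Proof.
move=> oU sF sG c ac.
exact: (smooth_onZ (open_chart_img c oU) (sF c ac) (sG c ac)).
Qed.

Lemma smooth_fun_continuous U F p : open U -> U p -> smooth_fun U F ->
  {for p, continuous F}.
Proof.
move=> oU Up sF P; rewrite /= => PF.
have cp := chart_at_dom p.
have cF : {for chart_at p p, continuous (F \o cinv (chart_at p))}.
  by apply: (smooth_on_continuous (sF _ (chart_at_atlas p))); exists p.
have : nbhs (chart_at p p) (fun z => P (F (cinv (chart_at p) z))).
  by apply: cF; rewrite /= cmapK.
move=> /(chart_nbhs cp) H; apply: filterS2 H (cdom_nbhs cp) => q /= + cq.
by rewrite cmapK.
Qed.

(** Compatibility of charts reduces smoothness inside the domain of one chart to
    smoothness in that chart. *)
Lemma smooth_fun_in_chart U F c : open U -> U `<=` cdom c -> atlas c ->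
  smooth_on (c @` U) (F \o cinv c) -> smooth_fun U F.
Proof.
move=> oU sU ac sF d ad.
have oV := open_chart_img d oU.
apply: (@smooth_on_eq _ _ _ _ oV ((F \o cinv c) \o (c \o cinv d))).
  by move=> _ [q [Uq dq] <-] /=; rewrite cmapK //; rewrite cmapK //; exact: sU.
apply: smooth_on_comp sF => //.
  by move=> _ [q [Uq dq] <-]; exists q => //=; rewrite cmapK.
apply: smooth_on_sub (transition_smooth ad ac).
by move=> _ [q [Uq dq] <-]; exists q => //; split=> //; exact: sU.
Qed.
End Functions.

Lemma smooth_funV U (f : M -> R) : open U -> (forall q, U q -> f q != 0) ->
  smooth_fun U f -> smooth_fun U (fun q => (f q)^-1).
Proof.
move=> oU f0 sf c ac.
apply: (smooth_onV (open_chart_img c oU) _ (sf c ac)).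
by move=> _ [q [Uq cq] <-] /=; rewrite cmapK //; exact: f0.
Qed.

Lemma smooth_fun_coord m U (F : M -> 'rV[R]_m) : open U ->
  smooth_fun U F <-> forall i, smooth_fun U (fun q => F q 0 i).
Proof.
move=> oU; split=> [sF i c ac|sF c ac].
  exact: ((smooth_on_coord (open_chart_img c oU) _).1 (sF c ac) i).
by apply/(smooth_on_coord (open_chart_img c oU)) => i; exact: sF.
Qed.

Lemma mderiv_coord m (F : M -> 'rV[R]_m) p v i : mdifferentiable F p ->
  mderiv (fun q => F q 0 i) p v = (mderiv F p v) 0 i.
Proof. by move=> dF; rewrite /mderiv -derive_coord. Qed.

(** Tangent vectors at [p] are stored as components in [chart_at p]. *)
Lemma mderiv_self p v : mderiv (chart_at p) p v = v.
Proof.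
have -> : mderiv (chart_at p) p v = 'D_v id (chart_at p p).
  apply: near_eq_derive; have := chart_img_nbhs (chart_at_dom p).
  by apply: filterS => _ [q cq <-] /=; rewrite cmapK.
by rewrite derive_id.
Qed.

Lemma derive_cinv_chart c q v : cdom c q -> 'D_v (c \o cinv c) (c q) = v.
Proof.
move=> cq; have -> : 'D_v (c \o cinv c) (c q) = 'D_v id (c q).
  apply: near_eq_derive; have := chart_img_nbhs cq.
  by apply: filterS => _ [r cr <-] /=; rewrite cmapK.
by rewrite derive_id.
Qed.

Lemma chart_mdiff c p : atlas c -> cdom c p -> mdifferentiable c p.
Proof.
move=> ac cp; apply: transition_differentiable => //.
  exact: chart_at_atlas.
exact: chart_at_dom.
Qed.

(** The vector field whose components in the chart [c] are [eta]: the differential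
    of the change of coordinates rewrites them at each [q] in [chart_at q], the
    chart in which tangent vectors at [q] are stored. *)
Definition chart_field c (eta : M -> 'rV[R]_n) (q : M) : 'rV[R]_n :=
  'D_(eta q) (chart_at q \o cinv c) (c q).

Lemma mderiv_chart_field c d eta q : atlas c -> atlas d -> cdom c q ->
  cdom d q -> mderiv d q (chart_field c eta q) = 'D_(eta q) (d \o cinv c) (c q).
Proof.
move=> ac ad cq dq; rewrite /mderiv /chart_field derive_chart_change //.
- exact: chart_at_atlas.
- exact: chart_at_dom.
exact: chart_mdiff.
Qed.

Lemma chart_fieldK c eta q : atlas c -> cdom c q ->
  mderiv c q (chart_field c eta q) = eta q.
Proof. by move=> ac cq; rewrite mderiv_chart_field // derive_cinv_chart. Qed.

Lemma chart_field_mderiv c q v : atlas c -> cdom c q ->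
  chart_field c (fun=> mderiv c q v) q = v.
Proof.
move=> ac cq; rewrite /chart_field derive_chart_change // ?mderiv_self //.
- exact: mderiv_self.
- exact: chart_at_atlas.
- exact: chart_at_dom.
apply: transition_differentiable => //; first exact: chart_at_atlas.
exact: chart_at_dom.
Qed.

Lemma smooth_fieldP U X : open U -> (forall c, atlas c ->
    smooth_on (c @` (U `&` cdom c)) ((fun q => mderiv c q (X q)) \o cinv c)) <->
  smooth_field U X.
Proof.
move=> oU; split=> [H c ac|H c ac].
  apply: (smooth_fun_in_chart _ _ ac (H c ac)); first exact: openI (@cdom_open _ _ _ c).
  by move=> q [].
by have := H c ac c ac; rewrite -setIA setIid.
Qed.

Lemma chart_field_smooth U c eta : open U -> U `<=` cdom c -> atlas c ->
  smooth_fun U eta -> smooth_field U (chart_field c eta).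
Proof.
move=> oU sU ac se d ad.
have oV : open (U `&` cdom d) by exact: openI (@cdom_open _ _ _ d).
apply: (smooth_fun_in_chart oV _ ac) => [q [/sU//]|].
have -> : c @` (U `&` cdom d) = c @` ((U `&` cdom d) `&` cdom c).
  by congr (_ @` _); apply/seteqP; split=> q [] // Uq dq; split=> //; exact: sU.
have oZ := open_chart_img c oV.
apply: (@smooth_on_eq _ _ _ _ oZ (fun z => 'D_((eta \o cinv c) z) (d \o cinv c) z)).
  move=> _ [q [[Uq dq] cq] <-] /=.
  by rewrite mderiv_chart_field ?cmapK.
apply: smooth_on_derive_dir => //.
  by apply: smooth_on_sub (se c ac) => _ [q [[Uq dq] cq] <-]; exists q => //; split.
apply: smooth_on_sub (transition_smooth ac ad) => _ [q [[Uq dq] cq] <-].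
by exists q => //; split.
Qed.
End Manifold.
Arguments open_chart_img {R n M} c [U] _.

(** * Vector fields and the Lie bracket *)

Section Fields.
Context {R : realType} {n : nat} {M : manifold R n}.
Implicit Types (c d : chart R n M) (p q : M) (U : set M) (X Y Z : M -> 'rV[R]_n).

Lemma smooth_fun_mderiv (W : normedModType R) U (F : M -> W) X : open U ->
  smooth_fun U F -> smooth_field U X -> smooth_fun U (fun q => mderiv F q (X q)).
Proof.
move=> oU sF sX c ac; have oZ := open_chart_img c oU.
have sE := (smooth_fieldP X oU).2 sX c ac.
apply: (@smooth_on_eq _ _ _ _ oZ (fun z =>
   'D_(((fun q => mderiv c q (X q)) \o cinv c) z) (F \o cinv c) z)).
  move=> _ [q [Uq cq] <-] /=; rewrite cmapK // -mderiv_chart //.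
  exact: smooth_fun_differentiable sF Uq ac cq.
exact: smooth_on_derive_dir (sF c ac).
Qed.

(** In the chart at [p] the derivative along [X] of the derivative along [Y] is a
    derivative of the components of [Y] plus a second derivative of [F].  The
    second derivatives cancel by symmetry, and the rest is the bracket. *)
Lemma mderiv_lie_scalar U (F : M -> R) X Y p : open U -> U p ->
  smooth_fun U F -> smooth_field U X -> smooth_field U Y ->
  mderiv (fun q => mderiv F q (Y q)) p (X p)
    - mderiv (fun q => mderiv F q (X q)) p (Y p) = mderiv F p (lie_bracket X Y p).
Proof.
move=> oU Up sF sX sY; set c := chart_at p.
have ac : atlas c := chart_at_atlas p.
have cp : cdom c p := chart_at_dom p.
have oZ := open_chart_img c oU.
have Zp : (c @` (U `&` cdom c)) (c p) by exists p.
have key Z Z' : smooth_field U Z ->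
    mderiv (fun q => mderiv F q (Z q)) p (Z' p) =
    'D_(mderiv (fun q => mderiv c q (Z q)) p (Z' p)) (F \o cinv c) (c p) +
    'D_(Z' p) (fun z => 'D_(Z p) (F \o cinv c) z) (c p).
  move=> sZ; have sE := (smooth_fieldP Z oU).2 sZ c ac.
  have -> : mderiv (fun q => mderiv F q (Z q)) p (Z' p) = 'D_(Z' p) (fun z =>
   'D_(((fun q => mderiv c q (Z q)) \o cinv c) z) (F \o cinv c) z) (c p).
    apply: derive_eq_on oZ Zp _ => _ [q [Uq cq] <-] /=.
    rewrite cmapK // -mderiv_chart //.
    exact: smooth_fun_differentiable sF Uq ac cq.
  have := derive_dir_derive (Z' p) oZ Zp sE (sF c ac).
  have -> : ((fun q => mderiv c q (Z q)) \o cinv c) (c p) = Z p.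
    by rewrite /= cmapK // mderiv_self.
  by [].
rewrite !key // (schwarz _ _ oZ (sF c ac 2%N) Zp).
have cancel (a b e : R) : a + b - (e + b) = a - e by ring.
apply: etrans (cancel _ _ _) _; rewrite /lie_bracket -/c mderivBv //.
exact: (smooth_fun_mdiff sF).
Qed.

Lemma mderiv_lie m U (F : M -> 'rV[R]_m) X Y p : open U -> U p ->
  smooth_fun U F -> smooth_field U X -> smooth_field U Y ->
  mderiv (fun q => mderiv F q (Y q)) p (X p)
    - mderiv (fun q => mderiv F q (X q)) p (Y p) = mderiv F p (lie_bracket X Y p).
Proof.
move=> oU Up sF sX sY; apply/rowP => i; rewrite [LHS]mxE [X in _ + X]mxE.
have sFi := (smooth_fun_coord F oU).1 sF i.
have coordE Z v : smooth_field U Z ->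
    (mderiv (fun q => mderiv F q (Z q)) p v) 0 i =
    mderiv (fun q => mderiv (fun r => F r 0 i) q (Z q)) p v.
  move=> sZ; have sD := smooth_fun_mderiv oU sF sZ.
  rewrite -(mderiv_coord v i (smooth_fun_mdiff sD Up)).
  apply: mderiv_eq_on oU Up _ => q Uq.
  by rewrite (mderiv_coord _ i (smooth_fun_mdiff sF Uq)).
apply: etrans (congr2 (fun a b => a - b) (coordE Y _ sY) (coordE X _ sX)) _.
apply: etrans (mderiv_lie_scalar oU Up sFi sX sY) _.
exact: mderiv_coord (smooth_fun_mdiff sF Up).
Qed.

Lemma smooth_field_sub U U' X : U' `<=` U -> smooth_field U X -> smooth_field U' X.
Proof.
move=> sU sX c ac; apply: smooth_fun_sub (sX c ac).
by move=> q [/sU].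
Qed.

Lemma smooth_field_eq U X Y : open U -> (forall q, U q -> X q = Y q) ->
  smooth_field U X -> smooth_field U Y.
Proof.
move=> oU XY sX c ac; apply: smooth_fun_eq (sX c ac) => [|q [Uq _]].
  exact: openI (@cdom_open _ _ _ c).
by rewrite XY.
Qed.

Lemma smooth_fieldD U X Y : open U -> smooth_field U X -> smooth_field U Y ->
  smooth_field U (fun q => X q + Y q).
Proof.
move=> oU sX sY c ac; have oV : open (U `&` cdom c) by exact: openI (@cdom_open _ _ _ c).
apply: smooth_fun_eq (smooth_funD oV (sX c ac) (sY c ac)) => // q [Uq cq].
by rewrite mderivDv //; exact: chart_mdiff.
Qed.

Lemma smooth_fieldZ U (f : M -> R) X : open U -> smooth_fun U f -> smooth_field U X ->
  smooth_field U (fun q => f q *: X q).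
Proof.
move=> oU sf sX c ac; have oV : open (U `&` cdom c) by exact: openI (@cdom_open _ _ _ c).
have sf' : smooth_fun (U `&` cdom c) f by apply: smooth_fun_sub sf => q [].
apply: smooth_fun_eq (smooth_funZ oV sf' (sX c ac)) => // q [Uq cq].
by rewrite mderivZv //; exact: chart_mdiff.
Qed.

Lemma smooth_field_on_near U p X : open U -> U p -> smooth_field U X ->
  smooth_field_near p X.
Proof. by exists U. Qed.

Lemma smooth_field_near_sub p X U : open U -> U p -> smooth_field_near p X ->
  exists V, [/\ open V, V p, V `<=` U & smooth_field V X].
Proof.
move=> oU Up [V [oV Vp sX]]; exists (V `&` U); split=> //; first exact: openI.
by apply: smooth_field_sub sX => q [].
Qed.

Lemma smooth_field_near_eq p X Y : smooth_field_near p X ->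
  (\forall q \near p, X q = Y q) -> smooth_field_near p Y.
Proof.
move=> [U [oU Up sX]] XY.
have : nbhs p (fun q => X q = Y q) by [].
rewrite nbhsE => -[V [oV Vp] VXY].
exists (U `&` V); split; [exact: openI|by split|].
apply: (@smooth_field_eq _ X) => [|q [_ /VXY]//|]; first exact: openI.
by apply: smooth_field_sub sX => q [].
Qed.

(** Connections act on fields, whereas metrics act on vectors: statements on vectors
    are reduced to fields by extending a vector with constant components in a
    chart. *)
Definition extension p (v : 'rV[R]_n) : M -> 'rV[R]_n :=
  chart_field (chart_at p) (fun=> v).

Lemma extensionE p v : extension p v p = v.
Proof. exact: mderiv_self. Qed.

Lemma extension_smooth p v : smooth_field_near p (extension p v).
Proof.
exists (cdom (chart_at p)); split.
- exact: cdom_open.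
- exact: chart_at_dom.
apply: chart_field_smooth => //; first exact: cdom_open.
  exact: chart_at_atlas.
exact: smooth_fun_cst.
Qed.
End Fields.

(** * Frames made of an immersion and two transversal fields *)

Section Frame.
Context {R : realType} {n : nat} {M : manifold R n}.
Variables (U : set M) (F A B : M -> 'rV[R]_n.+2).
Hypotheses (sF : smooth_fun U F) (sA : smooth_fun U A) (sB : smooth_fun U B).
Definition spanning_at (q : M) := forall w : 'rV[R]_n.+2,
  exists v a b, w = mderiv F q v + a *: A q + b *: B q.
Hypothesis FAB : forall q, U q -> spanning_at q.

(** The transversal vectors come first because [1 + 1 + n], unlike [n + (1 + 1)],
    is convertible to [n.+2]; so the frame is a square matrix of size [n.+2]. *)
Definition frame (c : chart R n M) (q : M) : 'M[R]_n.+2 :=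
  col_mx (col_mx (A q) (B q) : 'M[R]_(1 + 1, n.+2))
    (\matrix_i ('D_(delta_mx 0 i) (F \o cinv c) (c q))).

Definition frame_coef (a b : R) (v : 'rV[R]_n) : 'rV[R]_n.+2 :=
  row_mx (row_mx a%:M b%:M : 'rV[R]_(1 + 1)) v.

Lemma frame_coefP (c : chart R n M) q a b v : U q -> atlas c -> cdom c q ->
  frame_coef a b (mderiv c q v) *m frame c q = mderiv F q v + a *: A q + b *: B q.
Proof.
move=> Uq ac cq; rewrite /frame_coef /frame.
have dF := smooth_fun_differentiable sF Uq ac cq.
rewrite (@mul_row_col _ 1 (1 + 1) n n.+2) (@mul_row_col _ 1 1 1 n.+2).
rewrite !mul_scalar_mx [LHS]addrC addrA; congr (_ + _ + _).
rewrite (mderiv_chart _ ac cq dF) mulmx_sum_row (derive_lin_sum _ dF).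
by apply: eq_bigr => i _; rewrite rowK.
Qed.

(** Spanning vectors make the rows of the frame generate the whole space. *)
Lemma frame_unit (c : chart R n M) q : U q -> atlas c -> cdom c q ->
  frame c q \in unitmx.
Proof.
move=> Uq ac cq; rewrite -row_full_unit -sub1mx; apply/row_subP => i.
have [v [a [b ->]]] := FAB Uq (row i 1%:M).
by apply/submxP; exists (frame_coef a b (mderiv c q v)); rewrite frame_coefP.
Qed.

Lemma frame_coef_inj (a b : R) v a' b' v' :
  frame_coef a b v = frame_coef a' b' v' -> [/\ a = a', b = b' & v = v'].
Proof.
move=> /(@eq_row_mx _ 1 (1 + 1) n)[/(@eq_row_mx _ 1 1 1)[ea eb] ->].
by split=> //; [have := congr1 (fun x : 'M[R]_1 => x 0 0) ea |
  have := congr1 (fun x : 'M[R]_1 => x 0 0) eb]; rewrite !mxE eqxx.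
Qed.

Lemma frame_unique q v a b v' a' b' : U q ->
  mderiv F q v + a *: A q + b *: B q = mderiv F q v' + a' *: A q + b' *: B q ->
  [/\ v = v', a = a' & b = b'].
Proof.
move=> Uq; have ac := chart_at_atlas q; have cq := chart_at_dom q.
rewrite -!(frame_coefP _ _ _ Uq ac cq) => /(can_inj (mulmxK (frame_unit Uq ac cq))).
by rewrite !mderiv_self => /frame_coef_inj[-> -> ->].
Qed.

(** In each chart the components along the frame are obtained by applying the
    inverse matrix of the frame, whose entries are smooth. *)
Lemma frame_smooth V (w : M -> 'rV[R]_n.+2) X (a b : M -> R) : open V -> V `<=` U ->
  smooth_fun V w ->
  (forall q, V q -> w q = mderiv F q (X q) + a q *: A q + b q *: B q) ->
  [/\ smooth_field V X, smooth_fun V a & smooth_fun V b].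
Proof.
move=> oV sVU sw wE.
have key (c : chart R n M) : atlas c -> forall i, smooth_on (c @` (V `&` cdom c))
   (fun z => (frame_coef (a (cinv c z)) (b (cinv c z))
      (mderiv c (cinv c z) (X (cinv c z)))) 0 i).
  move=> ac i; have oZ := open_chart_img c oV.
  apply: (@smooth_on_eq _ _ _ _ oZ (fun z => \sum_j
     w (cinv c z) 0 j * invmx (frame c (cinv c z)) j i)).
    move=> _ [q [Vq cq] <-]; rewrite cmapK //; have Uq := sVU _ Vq.
    rewrite wE // -(frame_coefP _ _ _ Uq ac cq).
    set e := frame_coef _ _ _.
    by rewrite -[in RHS](mulmxK (frame_unit Uq ac cq) e) [RHS]mxE.
  apply: smooth_on_sum => // j _; apply: smooth_onM => //.
    exact: ((smooth_on_coord oZ _).1 (sw c ac) j).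
  have ZZ : c @` (V `&` cdom c) `<=` c @` (U `&` cdom c).
    by move=> _ [q [Vq cq] <-]; exists q => //; split=> //; exact: sVU.
  apply: (@smooth_on_invmx _ _ _ oZ _ (fun z => frame c (cinv c z))).
    move=> _ [q [Vq cq] <-]; rewrite cmapK //.
    by apply: frame_unit => //; exact: sVU.
  move=> k l; rewrite /frame.
  have [k' ->|k' ->] := @split_ordP (1 + 1) n k; last first.
    apply: (@smooth_on_eq _ _ _ _ oZ
      (fun z => ('D_(delta_mx 0 k') (F \o cinv c) z) 0 l)).
      by move=> _ [q [Vq cq] <-]; rewrite cmapK // (@col_mxEd _ (1 + 1) n) mxE.
    apply: ((smooth_on_coord oZ _).1 _ l).
    by apply: smooth_on_derive; exact: smooth_on_sub ZZ (sF ac).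
  have [k2 ->|k2 ->] := @split_ordP 1 1 k'; rewrite !ord1.
    apply: (@smooth_on_eq _ _ _ _ oZ (fun z => A (cinv c z) 0 l)).
      by move=> z _; rewrite (@col_mxEu _ (1 + 1) n) (@col_mxEu _ 1 1).
    exact: ((smooth_on_coord oZ _).1 (smooth_on_sub ZZ (sA ac)) l).
  apply: (@smooth_on_eq _ _ _ _ oZ (fun z => B (cinv c z) 0 l)).
    by move=> z _; rewrite (@col_mxEu _ (1 + 1) n) (@col_mxEd _ 1 1).
  exact: ((smooth_on_coord oZ _).1 (smooth_on_sub ZZ (sB ac)) l).
split.
- apply/(smooth_fieldP _ oV) => c ac; have oZ := open_chart_img c oV.
  apply/(smooth_on_coord oZ) => i.
  apply: (smooth_on_eq oZ _ (key c ac (@rshift (1 + 1) n i))) => z _.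
  by rewrite (@row_mxEr _ _ (1 + 1) n).
- move=> c ac; have oZ := open_chart_img c oV.
  apply: (smooth_on_eq oZ _ (key c ac (@lshift (1 + 1) n (@lshift 1 1 0)))) => z _.
  by rewrite (@row_mxEl _ _ (1 + 1) n) (@row_mxEl _ _ 1 1) mxE eqxx.
move=> c ac; have oZ := open_chart_img c oV.
apply: (smooth_on_eq oZ _ (key c ac (@lshift (1 + 1) n (@rshift 1 1 0)))) => z _.
by rewrite (@row_mxEl _ _ (1 + 1) n) (@row_mxEr _ _ 1 1) mxE eqxx.
Qed.
End Frame.

(** * Consequences of a Gauss formula *)

(** Identities between combinations of a tangent part and two transversal vectors,
    used to read off the components of a derivative. *)
Section LinearCombinations.
Context {R : realType} {m : nat}.
Implicit Types (u w A B : 'rV[R]_m) (a s t : R).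

Lemma combo_linear a u w A B s s' t t' :
  a *: (u + s *: A + t *: B) + (w + s' *: A + t' *: B) =
  (a *: u + w) + (a * s + s') *: A + (a * t + t') *: B.
Proof. by apply/rowP => i; rewrite !mxE; ring. Qed.

Lemma combo_sub u w A B s s' t t' :
  (u + s *: A + t *: B) - (w + s' *: A + t' *: B) =
  (u - w) + (s - s') *: A + (t - t') *: B.
Proof. by apply/rowP => i; rewrite !mxE; ring. Qed.

Lemma combo_pure u A B : u = u + 0 *: A + 0 *: B.
Proof. by rewrite !scale0r !addr0. Qed.

Lemma combo_add u w A B s s' t t' :
  (u + s *: A + t *: B) + (w + s' *: A + t' *: B) =
  (u + w) + (s + s') *: A + (t + t') *: B.
Proof. by apply/rowP => i; rewrite !mxE; ring. Qed.

Lemma combo_scale a b u w A B s t :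
  b *: w + a *: (u + s *: A + t *: B) =
  (b *: w + a *: u) + (a * s) *: A + (a * t) *: B.
Proof. by apply/rowP => i; rewrite !mxE; ring. Qed.

Lemma combo_second u A B s t s' t' c e u1 s1 u2 s2 :
  u + s *: A + t *: B + (s' *: A + c *: (u1 + s1 *: B))
    + (t' *: B + e *: (u2 + s2 *: B)) =
  (u + c *: u1 + e *: u2) + (s + s') *: A + (t + c * s1 + t' + e * s2) *: B.
Proof. by apply/rowP => i; rewrite !mxE; ring. Qed.

Lemma combo_constant u w A B k s t s' t' c e :
  u + s *: A + t *: B + (s' *: A + c *: (w + e *: B)) + (t' *: B + k) =
  (u + c *: w + k) + (s + s') *: A + (t + c * e + t') *: B.
Proof. by apply/rowP => i; rewrite !mxE; ring. Qed.

Lemma combo_flat u A B w s s' c :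
  u + s *: A + 0 *: B + (s' *: A + c *: 0) + (0 *: B + 0 *: w) =
  u + (s + s') *: A + 0 *: B.
Proof. by rewrite !scale0r scaler0 !addr0 scalerDl addrA. Qed.

Lemma exchange_terms (a b c d e e' : R) :
  a + b - (c + d) = e - e' -> b - e - c = d - e' - a.
Proof. by move=> H; lra. Qed.
End LinearCombinations.

Section GaussFormula.
Context {R : realType} {n : nat} {M : manifold R n}.
Variables (U : set M) (F A B : M -> 'rV[R]_n.+2).
Hypotheses (oU : open U) (sF : smooth_fun U F) (sA : smooth_fun U A)
  (sB : smooth_fun U B) (FAB : forall q, U q -> spanning_at F A B q).
Variables (nabla : connection M) (h T : M -> 'rV[R]_n -> 'rV[R]_n -> R).
Hypothesis gauss : forall p X Y, U p -> smooth_field_near p X ->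
  smooth_field_near p Y ->
  mderiv (fun q => mderiv F q (Y q)) p (X p) =
    mderiv F p (nabla p (X p) Y) + h p (X p) (Y p) *: A p
    + T p (X p) (Y p) *: B p.
Implicit Types (p q : M) (X Y Z : M -> 'rV[R]_n) (v w : 'rV[R]_n).

(** The Gauss formula depends on its first field through its value at [p] only. *)
Lemma gaussE p v Y : U p -> smooth_field_near p Y ->
  mderiv (fun q => mderiv F q (Y q)) p v =
    mderiv F p (nabla p v Y) + h p v (Y p) *: A p + T p v (Y p) *: B p.
Proof.
move=> Up nY; have := gauss Up (extension_smooth p v) nY.
by rewrite extensionE.
Qed.

Lemma gauss_unique p v Y u s t : U p -> smooth_field_near p Y ->
  mderiv (fun q => mderiv F q (Y q)) p v = mderiv F p u + s *: A p + t *: B p ->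
  [/\ nabla p v Y = u, h p v (Y p) = s & T p v (Y p) = t].
Proof.
move=> Up nY E.
exact: (frame_unique sF FAB Up (etrans (esym (gaussE v Up nY)) E)).
Qed.

Lemma immersion_mdiff p : U p -> mdifferentiable F p.
Proof. exact: smooth_fun_mdiff. Qed.

Lemma push_smooth V Y : open V -> V `<=` U -> smooth_field V Y ->
  smooth_fun V (fun q => mderiv F q (Y q)).
Proof. by move=> oV VU sY; apply: smooth_fun_mderiv => //; exact: smooth_fun_sub sF. Qed.

Lemma push_mdiff p Y : U p -> smooth_field_near p Y ->
  mdifferentiable (fun q => mderiv F q (Y q)) p.
Proof.
move=> Up /(smooth_field_near_sub oU Up)[V [oV Vp VU sY]].
exact: (smooth_fun_mdiff (push_smooth oV VU sY) Vp).
Qed.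

Lemma gauss_linear p a v w Y : U p -> smooth_field_near p Y ->
  [/\ nabla p (a *: v + w) Y = a *: nabla p v Y + nabla p w Y,
      h p (a *: v + w) (Y p) = a * h p v (Y p) + h p w (Y p) &
      T p (a *: v + w) (Y p) = a * T p v (Y p) + T p w (Y p)].
Proof.
move=> Up nY; apply: gauss_unique => //.
apply: etrans (mderiv_linear a v w (push_mdiff Up nY)) _.
rewrite (gaussE v Up nY) (gaussE w Up nY) mderiv_linear; last exact: immersion_mdiff.
exact: combo_linear.
Qed.

(** Both claims are components of D_X dF(Y) - D_Y dF(X) = dF([X, Y]), whose
    right-hand side is tangent. *)
Lemma gauss_bracket p X Y : U p -> smooth_field_near p X -> smooth_field_near p Y ->
  nabla p (X p) Y - nabla p (Y p) X = lie_bracket X Y p /\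
  h p (X p) (Y p) = h p (Y p) (X p).
Proof.
move=> Up nX nY.
have [V [oV Vp VU sX]] := smooth_field_near_sub oU Up nX.
have [V' [oV' Vp' VV' sY]] := smooth_field_near_sub oV Vp nY.
have sX' := smooth_field_sub VV' sX.
have sF' : smooth_fun V' F by apply: smooth_fun_sub sF => q /VV'/VU.
have E : mderiv F p (nabla p (X p) Y - nabla p (Y p) X)
    + (h p (X p) (Y p) - h p (Y p) (X p)) *: A p
    + (T p (X p) (Y p) - T p (Y p) (X p)) *: B p = mderiv F p (lie_bracket X Y p).
  rewrite (mderivBv _ _ (immersion_mdiff Up)) -combo_sub -(gaussE (X p) Up nY).
  by rewrite -(gaussE (Y p) Up nX) (mderiv_lie oV' Vp' sF' sX' sY).
have [-> /eqP + _] := frame_unique sF FAB Up (etrans E (combo_pure _ (A p) (B p))).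
by rewrite subr_eq0 => /eqP.
Qed.

Lemma form_sym p v w : U p -> h p v w = h p w v.
Proof.
move=> Up; have [_] := gauss_bracket Up (extension_smooth p v) (extension_smooth p w).
by rewrite !extensionE.
Qed.

Lemma form_linear p a v w z : U p ->
  h p (a *: v + w) z = a * h p v z + h p w z.
Proof.
move=> Up; have [_ + _] := gauss_linear a v w Up (extension_smooth p z).
by rewrite !extensionE.
Qed.

Lemma form_subl p v w z : U p -> h p (v - w) z = h p v z - h p w z.
Proof.
by move=> Up; rewrite addrC -scaleN1r form_linear // mulN1r addrC.
Qed.

Lemma gauss_smooth V X Y : open V -> V `<=` U -> smooth_field V X ->
  smooth_field V Y ->
  [/\ smooth_field V (fun q => nabla q (X q) Y),
      smooth_fun V (fun q => h q (X q) (Y q)) &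
      smooth_fun V (fun q => T q (X q) (Y q))].
Proof.
move=> oV VU sX sY.
have sw := smooth_fun_mderiv oV (push_smooth oV VU sY) sX.
apply: (frame_smooth sF sA sB FAB oV VU sw) => q Vq.
exact: (gaussE (X q) (VU q Vq) (smooth_field_on_near oV Vq sY)).
Qed.

Lemma gauss_connection : affine_connection U nabla.
Proof.
split.
- move=> p v Y Y' Up nY YY'; have nY' := smooth_field_near_eq nY YY'.
  have E : mderiv (fun q => mderiv F q (Y q)) p v = mderiv (fun q => mderiv F q (Y' q)) p v.
    by apply: mderiv_near; apply: filterS YY' => q ->.
  by have [] := gauss_unique Up nY (etrans E (gaussE v Up nY')).
- by move=> p a v w Y Up nY; have [] := gauss_linear a v w Up nY.
- move=> p v Y Z Up nY nZ.
  have [V [oV Vp VU sY]] := smooth_field_near_sub oU Up nY.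
  have [V' [oV' Vp' VV' sZ]] := smooth_field_near_sub oV Vp nZ.
  have sY' := smooth_field_sub VV' sY.
  have nYZ : smooth_field_near p (fun q => Y q + Z q).
    exact: smooth_field_on_near oV' Vp' (smooth_fieldD oV' sY' sZ).
  have E : mderiv (fun q => mderiv F q (Y q + Z q)) p v =
      mderiv F p (nabla p v Y + nabla p v Z)
      + (h p v (Y p) + h p v (Z p)) *: A p + (T p v (Y p) + T p v (Z p)) *: B p.
    rewrite (mderivDv _ _ (immersion_mdiff Up)) -combo_add -(gaussE v Up nY) -(gaussE v Up nZ).
    rewrite -(mderivD v (push_mdiff Up nY) (push_mdiff Up nZ)).
    apply: (mderiv_eq_on _ oV' Vp') => q /VV'/VU Uq.
    exact: mderivDv (immersion_mdiff Uq).
  by have [] := gauss_unique Up nYZ E.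
- move=> p v u Y Up [V1 [oV1 Vp1 su]] nY.
  have [V [oV Vp VU sY]] := smooth_field_near_sub oU Up nY.
  pose V' := V1 `&` V.
  have oV' : open V' by exact: openI.
  have Vp' : V' p by split.
  have su' : smooth_fun V' u by apply: smooth_fun_sub su => q [].
  have sY' : smooth_field V' Y by apply: smooth_field_sub sY => q [].
  have nuY : smooth_field_near p (fun q => u q *: Y q).
    exact: smooth_field_on_near oV' Vp' (smooth_fieldZ oV' su' sY').
  have E : mderiv (fun q => mderiv F q (u q *: Y q)) p v =
      mderiv F p (mderiv u p v *: Y p + u p *: nabla p v Y)
      + (u p * h p v (Y p)) *: A p + (u p * T p v (Y p)) *: B p.
    rewrite (mderivDv _ _ (immersion_mdiff Up)) !(mderivZv _ _ (immersion_mdiff Up)).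
    rewrite -combo_scale.
    rewrite -(gaussE v Up nY) -(mderivZ v (smooth_fun_mdiff su' Vp') (push_mdiff Up nY)).
    apply: (mderiv_eq_on _ oV' Vp') => q [_ /VU Uq].
    exact: mderivZv (immersion_mdiff Uq).
  by have [] := gauss_unique Up nuY E.
- by move=> W X Y oW WU sX sY; have [] := gauss_smooth oW WU sX sY.
by move=> p X Y Up nX nY; have [] := gauss_bracket Up nX nY.
Qed.

Lemma gauss_metric : nondegenerate_on U h -> pseudo_riemannian U h.
Proof.
move=> nd; split=> //.
- by move=> p a v w z Up; exact: form_linear.
- by move=> p v w Up; exact: form_sym.
by move=> W X Y oW WU sX sY; have [] := gauss_smooth oW WU sX sY.
Qed.

(** The derivative of a field along the immersion that is given by its components.
    It is applied to the derivative of dF(Z), to compute second derivatives, and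
    to constant vectors. *)
Lemma gauss_frame_derivative V p v X (a b : M -> R) :
  open V -> V p -> V `<=` U -> smooth_field V X -> smooth_fun V a ->
  smooth_fun V b ->
  mderiv (fun q => mderiv F q (X q) + a q *: A q + b q *: B q) p v =
  mderiv F p (nabla p v X) + h p v (X p) *: A p + T p v (X p) *: B p
  + (mderiv a p v *: A p + a p *: mderiv A p v)
  + (mderiv b p v *: B p + b p *: mderiv B p v).
Proof.
move=> oV Vp VU sX sa sb; have Up := VU _ Vp.
have nX := smooth_field_on_near oV Vp sX.
have saA := smooth_funZ oV sa (smooth_fun_sub VU sA).
have sbB := smooth_funZ oV sb (smooth_fun_sub VU sB).
rewrite -(mderivZ v (smooth_fun_mdiff sa Vp) (smooth_fun_mdiff sA Up)).
rewrite -(mderivZ v (smooth_fun_mdiff sb Vp) (smooth_fun_mdiff sB Up)).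
rewrite -(gaussE v Up nX).
rewrite -(mderivD v (push_mdiff Up nX) (smooth_fun_mdiff saA Vp)).
have dXA := smooth_fun_mdiff (smooth_funD oV (push_smooth oV VU sX) saA) Vp.
by rewrite -(mderivD v dXA (smooth_fun_mdiff sbB Vp)).
Qed.

Lemma gauss_second p X Y Z : U p -> smooth_field_near p Y -> smooth_field_near p Z ->
  mderiv (fun q => mderiv (fun r => mderiv F r (Z r)) q (Y q)) p (X p) =
  mderiv F p (nabla p (X p) (fun q => nabla q (Y q) Z))
  + h p (X p) (nabla p (Y p) Z) *: A p + T p (X p) (nabla p (Y p) Z) *: B p
  + (mderiv (fun q => h q (Y q) (Z q)) p (X p) *: A p
     + h p (Y p) (Z p) *: mderiv A p (X p))
  + (mderiv (fun q => T q (Y q) (Z q)) p (X p) *: B p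
     + T p (Y p) (Z p) *: mderiv B p (X p)).
Proof.
move=> Up nY nZ.
have [V1 [oV1 Vp1 VU1 sY]] := smooth_field_near_sub oU Up nY.
have [V [oV Vp VV1 sZ]] := smooth_field_near_sub oV1 Vp1 nZ.
have VU : V `<=` U by move=> q /VV1/VU1.
have [sN sh sT] := gauss_smooth oV VU (smooth_field_sub VV1 sY) sZ.
rewrite -(gauss_frame_derivative (X p) oV Vp VU sN sh sT).
apply: (mderiv_eq_on _ oV Vp) => q Vq.
exact: (gaussE (Y q) (VU q Vq) (smooth_field_on_near oV Vq sZ)).
Qed.

(** The A-component of D_X D_Y dF(Z) - D_Y D_X dF(Z) = D_[X,Y] dF(Z).  Since the
    derivatives of [A] and [B] have no A-component, that of D_X D_Y dF(Z) is
    h(X, nabla_Y Z) + X h(Y, Z).  Absence of torsion replaces [X, Y] on the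
    right-hand side. *)
Lemma gauss_codazzi p X Y Z :
  (forall p v, U p -> exists u s, mderiv A p v = mderiv F p u + s *: B p) ->
  (forall p v, U p -> exists u s, mderiv B p v = mderiv F p u + s *: B p) ->
  U p -> smooth_field_near p X -> smooth_field_near p Y -> smooth_field_near p Z ->
  cov_metric nabla h X Y Z p = cov_metric nabla h Y X Z p.
Proof.
move=> WA WB Up nX nY nZ.
have key X' Y' : smooth_field_near p Y' -> exists u t,
  mderiv (fun q => mderiv (fun r => mderiv F r (Z r)) q (Y' q)) p (X' p) =
  mderiv F p u + (h p (X' p) (nabla p (Y' p) Z)
     + mderiv (fun q => h q (Y' q) (Z q)) p (X' p)) *: A p + t *: B p.
  move=> nY'; rewrite gauss_second //.
  have [u1 [s1 ->]] := WA p (X' p) Up; have [u2 [s2 ->]] := WB p (X' p) Up.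
  exists (nabla p (X' p) (fun q => nabla q (Y' q) Z)
    + h p (Y' p) (Z p) *: u1 + T p (Y' p) (Z p) *: u2); eexists.
  rewrite !(mderivDv _ _ (immersion_mdiff Up)) !(mderivZv _ _ (immersion_mdiff Up)).
  exact: combo_second.
have [u1 [t1 E1]] := key X Y nY; have [u2 [t2 E2]] := key Y X nX.
have [V1 [oV1 Vp1 VU1 sY]] := smooth_field_near_sub oU Up nY.
have [V2 [oV2 Vp2 VV1 sZ]] := smooth_field_near_sub oV1 Vp1 nZ.
have [V [oV Vp VV2 sX]] := smooth_field_near_sub oV2 Vp2 nX.
have VU : V `<=` U by move=> q /VV2/VV1/VU1.
have sZ' := smooth_field_sub VV2 sZ.
have sY' : smooth_field V Y by apply: smooth_field_sub sY => q /VV2/VV1.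
have lieE := mderiv_lie oV Vp (push_smooth oV VU sZ') sX sY'.
have E := etrans (etrans (esym (congr2 (fun a b => a - b) E1 E2)) lieE)
  (gaussE (lie_bracket X Y p) Up nZ).
rewrite -[LHS]/(_ - _) combo_sub -(mderivBv _ _ (immersion_mdiff Up)) in E.
have [_ + _] := frame_unique sF FAB Up E.
have [<- _] := gauss_bracket Up nX nY.
rewrite form_subl //.
exact: exchange_terms.
Qed.

Lemma gauss_statistical : nondegenerate_on U h ->
  (forall p v, U p -> exists u s, mderiv A p v = mderiv F p u + s *: B p) ->
  (forall p v, U p -> exists u s, mderiv B p v = mderiv F p u + s *: B p) ->
  statistical U nabla h.
Proof.
move=> nd WA WB; split; [exact: gauss_metric|exact: gauss_connection|].
move=> p X Y Z Up nX nY nZ; split; first exact: gauss_codazzi.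
rewrite /cov_metric (form_sym (nabla p (X p) Y)) // (form_sym (Y p)) //.
rewrite addrAC; congr (_ - _ - _).
by apply: mderiv_eq_on oU Up _ => q Uq; exact: form_sym.
Qed.

(** The tangent component of D_X D_Y dF(Z) - D_Y D_X dF(Z) = D_[X,Y] dF(Z).  When
    [A] is constant and [T] is zero, the transversal part of D_Y dF(Z) does not
    contribute to it. *)
Lemma gauss_flat : (forall p v, U p -> mderiv A p v = 0) ->
  (forall p v w, U p -> T p v w = 0) -> flat_on U nabla.
Proof.
move=> A0 T0 p X Y Z Up nX nY nZ.
have key X' Y' : smooth_field_near p Y' ->
  mderiv (fun q => mderiv (fun r => mderiv F r (Z r)) q (Y' q)) p (X' p) =
  mderiv F p (nabla p (X' p) (fun q => nabla q (Y' q) Z))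
  + (h p (X' p) (nabla p (Y' p) Z)
     + mderiv (fun q => h q (Y' q) (Z q)) p (X' p)) *: A p + 0 *: B p.
  move=> nY'; rewrite gauss_second // A0 // !T0 //.
  have -> : mderiv (fun q => T q (Y' q) (Z q)) p (X' p) = 0.
    rewrite -[RHS](mderiv_cst (0 : R) p (X' p)).
    by apply: mderiv_eq_on oU Up _ => q Uq; exact: T0.
  exact: combo_flat.
have [V1 [oV1 Vp1 VU1 sY]] := smooth_field_near_sub oU Up nY.
have [V2 [oV2 Vp2 VV1 sZ]] := smooth_field_near_sub oV1 Vp1 nZ.
have [V [oV Vp VV2 sX]] := smooth_field_near_sub oV2 Vp2 nX.
have VU : V `<=` U by move=> q /VV2/VV1/VU1.
have sZ' := smooth_field_sub VV2 sZ.
have sY' : smooth_field V Y by apply: smooth_field_sub sY => q /VV2/VV1.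
have lieE := mderiv_lie oV Vp (push_smooth oV VU sZ') sX sY'.
have E := etrans (etrans (esym (congr2 (fun a b => a - b) (key X Y nY) (key Y X nX)))
  lieE) (gaussE (lie_bracket X Y p) Up nZ).
rewrite -[LHS]/(_ - _) combo_sub -(mderivBv _ _ (immersion_mdiff Up)) in E.
have [+ _ _] := frame_unique sF FAB Up E.
by rewrite /curvature => ->; rewrite subrr.
Qed.
End GaussFormula.

(** * Flat coordinates of the ambient manifold *)

Section AffineCoordinates.
Context {R : realType} {n m : nat} {N : manifold R m} {M : manifold R n}.
Variables (theta : chart R m N) (nablaN : connection N).
Hypotheses (atheta : atlas theta) (dtheta : cdom theta = [set: N])
  (cN : affine_connection [set: N] nablaN)
  (theta_flat : forall p i j,
    nablaN p (coord_field theta i p) (coord_field theta j) = 0).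

Lemma cdom_theta q : cdom theta q.
Proof. by rewrite dtheta. Qed.

Lemma theta_mdiff q : mdifferentiable theta q.
Proof. exact: chart_mdiff (cdom_theta q). Qed.

Lemma mderiv_theta_coord_field i q : mderiv theta q (coord_field theta i q) = delta_mx 0 i.
Proof. exact: (chart_fieldK (fun=> delta_mx 0 i) atheta (cdom_theta q)). Qed.

Lemma mderiv_sumv (W : normedModType R) (G : N -> W) q k (w : 'I_k -> 'rV[R]_m) :
  mdifferentiable G q -> mderiv G q (\sum_i w i) = \sum_i mderiv G q (w i).
Proof.
move=> dG; rewrite /mderiv deriveE // linear_sum.
by apply: eq_bigr => i _; rewrite deriveE.
Qed.

Lemma mderiv_theta_sum (a : 'rV[R]_m) q :
  mderiv theta q (\sum_i a 0 i *: coord_field theta i q) = a.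
Proof.
rewrite (mderiv_sumv _ (theta_mdiff q)) [RHS]row_sum_delta.
apply: eq_bigr => i _; rewrite (mderivZv _ _ (theta_mdiff q)).
by rewrite mderiv_theta_coord_field.
Qed.

Lemma mderiv_theta_inj q v w : mderiv theta q v = mderiv theta q w -> v = w.
Proof.
move=> E; rewrite -(chart_field_mderiv v atheta (cdom_theta q)) E.
exact: (chart_field_mderiv w atheta (cdom_theta q)).
Qed.

Lemma mderiv_theta_radial q : mderiv theta q (radial theta q) = theta q.
Proof. exact: (mderiv_theta_sum (theta q) q). Qed.

Lemma coord_field_smooth j q : smooth_field_near q (coord_field theta j).
Proof.
exists [set: N]; split=> //; first exact: openT.
apply: (@chart_field_smooth _ _ _ _ theta (fun=> delta_mx 0 j)) => //; first exact: openT.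
  by rewrite dtheta.
exact: smooth_fun_cst.
Qed.

(** The coordinate fields are parallel in coordinate directions, which span. *)
Lemma christoffel0 q v j : nablaN q v (coord_field theta j) = 0.
Proof.
have -> : v = \sum_i mderiv theta q v 0 i *: coord_field theta i q.
  by apply: (@mderiv_theta_inj q); rewrite mderiv_theta_sum.
have nabla0 : nablaN q 0 (coord_field theta j) = 0.
  have := conn_linear cN (-1) 0 0 (I : [set: N] q) (coord_field_smooth j q).
  by rewrite scaler0 addr0 scaleN1r addNr.
elim/big_rec : _ => // i w _ IH.
by rewrite (conn_linear cN _ _ _ (I : [set: N] q) (coord_field_smooth j q)) IH
  theta_flat scaler0 addr0.
Qed.

Variable f : M -> N.
Hypothesis sf : smooth_map f.

Lemma smooth_theta_f : smooth_fun [set: M] (theta \o f).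
Proof. by have := sf.2 theta atheta; rewrite dtheta preimage_setT. Qed.

Lemma smooth_theta_along W : smooth_along f W ->
  smooth_fun [set: M] (fun q => mderiv theta (f q) (W q)).
Proof. by move=> /(_ theta atheta); rewrite dtheta preimage_setT. Qed.

Lemma mderiv_theta_pushforward p v :
  mderiv theta (f p) (Defs.pushforward f p v) = mderiv (theta \o f) p v.
Proof.
have ac := chart_at_atlas p; have cp := chart_at_dom p.
have ad := chart_at_atlas (f p); have dfp := chart_at_dom (f p).
set c := chart_at p in ac cp *; set d := chart_at (f p) in ad dfp *.
have dFd : differentiable ((d \o f) \o cinv c) (c p).
  exact: (smooth_fun_differentiable (sf.2 d ad) _ ac cp).
have E : ((d \o f) \o cinv c) (c p) = d (f p) by rewrite /= cmapK.
have dG : differentiable (theta \o cinv d) (((d \o f) \o cinv c) (c p)).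
  by rewrite E; exact: theta_mdiff.
have := derive_comp v dFd dG; rewrite E => E'.
apply: etrans (esym E') _; apply: near_eq_derive.
have : nbhs p (fun q => cdom d (f q)) by apply: sf.1; exact: cdom_nbhs.
move=> /(cinv_nbhs cp); apply: filterS => z dz /=.
by rewrite cmapK.
Qed.

(** As the coordinate fields are parallel, only the components are
    differentiated. *)
Lemma mderiv_theta_along p v W :
  mdifferentiable (fun q => mderiv theta (f q) (W q)) p ->
  mderiv theta (f p) (along_derivative nablaN theta f p v W) =
  mderiv (fun q => mderiv theta (f q) (W q)) p v.
Proof.
move=> dw; rewrite -[RHS](mderiv_theta_sum _ (f p)); congr (mderiv _ _ _).
apply: eq_bigr => i _; rewrite christoffel0 scaler0 addr0; congr (_ *: _).
exact: mderiv_coord.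
Qed.
End AffineCoordinates.

(** * Linear forms and logarithms of functions *)

Section Covector.
Context {R : realType} {m : nat}.
Variable alpha : 'cV[R]_m.

Definition covec (w : 'rV[R]_m) : R := (w *m alpha) 0 0.

Lemma covec_is_linear : linear covec.
Proof. by move=> a u v; rewrite /covec mulmxDl -scalemxAl !mxE. Qed.
HB.instance Definition _ :=
  GRing.isLinear.Build R 'rV[R]_m R _ covec covec_is_linear.

Lemma covec_smooth : smooth_on [set: 'rV[R]_m] covec.
Proof.
have oT : open [set: 'rV[R]_m] by exact: openT.
apply: (smooth_on_eq oT (F := fun w : 'rV[R]_m => \sum_j w 0 j * alpha j 0)).
  by move=> w _; rewrite /covec mxE.
apply: smooth_on_sum; first exact: openT.
move=> j _; apply: smooth_onM; [exact: openT| |exact: smooth_on_cst].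
by move=> k; apply: (Ck_on_lin k _ (@coordl_continuous _ _ j)).
Qed.

Context {n : nat} {M : manifold R n}.

Lemma mderiv_covec (F : M -> 'rV[R]_m) p v : mdifferentiable F p ->
  mderiv (fun q => covec (F q)) p v = covec (mderiv F p v).
Proof.
move=> dF; have cc : continuous covec.
  by move=> w; exact: (smooth_on_continuous covec_smooth).
have dc w : differentiable covec w by exact: (smooth_on_differentiable covec_smooth).
apply: etrans (derive_comp v dF (dc _)) _.
by rewrite deriveE // diff_lin.
Qed.

Lemma smooth_covec U (F : M -> 'rV[R]_m) : open U -> smooth_fun U F ->
  smooth_fun U (fun q => covec (F q)).
Proof.
move=> oU sF c ac.
exact: (smooth_on_comp (open_chart_img c oU) _ (sF c ac) covec_smooth).
Qed.
End Covector.

Section Logarithm.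
Context {R : realType} {n : nat} {M : manifold R n}.
Variables (f : M -> R) (p : M) (v : 'rV[R]_n).
Hypotheses (df : mdifferentiable f p) (fp : 0 < f p).

Lemma mderiv_ln : mderiv (fun q => ln (f q)) p v = (f p)^-1 * mderiv f p v.
Proof.
have E : (f \o cinv (chart_at p)) (chart_at p p) = f p.
  by rewrite /= cmapK //; exact: chart_at_dom.
have [dl lE] : is_derive ((f \o cinv (chart_at p)) (chart_at p p)) 1 (@ln R) (f p)^-1.
  by rewrite E; exact: is_derive1_ln.
have dl' : differentiable (@ln R) ((f \o cinv (chart_at p)) (chart_at p p)).
  exact/derivable1_diffP.
rewrite /mderiv deriveE; last exact: (differentiable_comp df dl').
rewrite (diff_comp df dl') /= -(deriveE v df).
rewrite -[X in 'd _ _ X]mulr1 -[_ * 1]/(_ *: 1) linearZ /=.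
by rewrite -(deriveE (1 : R) dl') lE mulrC.
Qed.

Lemma mderivV : mderiv (fun q => (f q)^-1) p v = - (f p) ^- 2 * mderiv f p v.
Proof.
have E : (f \o cinv (chart_at p)) (chart_at p p) = f p.
  by rewrite /= cmapK //; exact: chart_at_dom.
rewrite /mderiv (@deriveV _ _ (f \o cinv (chart_at p))) ?E ?gt_eqF //.
exact: diff_derivable.
Qed.
End Logarithm.

(** * The flat structure near a point *)

Section Coframe.
Context {R : realType} {n : nat} {M : manifold R n}.
Variables (U : set M) (F A B : M -> 'rV[R]_n.+2).
Hypotheses (sF : smooth_fun U F) (FAB : forall q, U q -> spanning_at F A B q).

(** The linear form of the basis dual to the frame at [p] that corresponds to
    [B p]. *)
Lemma coframe p : U p -> exists alpha : 'cV[R]_n.+2,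
  forall v a b, covec alpha (mderiv F p v + a *: A p + b *: B p) = b.
Proof.
move=> Up; have ac := chart_at_atlas p; have cp := chart_at_dom p.
set c := chart_at p in ac cp.
pose i0 : 'I_n.+2 := @lshift (1 + 1) n (@rshift 1 1 0).
exists (invmx (frame F A B c p) *m delta_mx i0 0) => v a b.
rewrite -(frame_coefP A B sF a b v Up ac cp) /covec mulmxA.
rewrite (mulmxK (frame_unit sF FAB Up ac cp)) -colE mxE.
by rewrite /frame_coef (@row_mxEl _ _ (1 + 1) n) (@row_mxEr _ _ 1 1) mxE eqxx.
Qed.
End Coframe.

Section ConformalCombinations.
Context {R : realType} {m : nat}.
Implicit Types (x A b : 'rV[R]_m).

(** The left-hand side is D_X dF(Y) for F = psi x, written with the Gauss formula of
    x; the first summand on the right is dF(nabla'_X Y).  Eliminating A by means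
    of b gives equality up to a multiple of F, because psi lam = 1 makes the terms
    of nabla' account for the tangent part.  Here [XY] and [Xv] stand for dx(Y)
    and dx(X), and [Bt] for dx(beta). *)
Lemma conformal_gauss x A b Bt N XY Xv (psi lam mu nu h t a v' y' c : R) :
  psi * lam = 1 -> mu != 0 -> b = Bt + mu *: A + nu *: x ->
  exists r, a *: x + y' *: Xv + (v' *: XY + psi *: (N + h *: A + t *: x)) =
    (c *: x + psi *: (N + (lam * v') *: XY + (lam * y') *: Xv - (h / mu) *: Bt))
    + (mu^-1 * psi * h) *: b + r *: (psi *: x).
Proof.
move=> pl mu0 ->; exists (lam * (a + psi * t - c - mu^-1 * psi * h * nu)).
have l0 : lam != 0 by apply: contra_eq_neq pl => ->; rewrite mulr0 eq_sym oner_eq0.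
have lp : psi = lam^-1 by apply: (mulIf l0); rewrite pl mulVf.
by apply/rowP => i; rewrite !mxE lp; field; rewrite mu0 l0.
Qed.

(** Substituting for A in terms of b, and for x in terms of psi x, turns the frame
    (x, A, x) into (psi x, b, psi x).  The tangent vector of psi x is the image of
    lam v - (lam a / mu) beta, where [Xv] = dx(v) and [Bt] = dx(beta); [e] and
    [eb] are the derivatives of psi along its two terms. *)
Lemma conformal_span x A b Bt Xv (psi lam mu nu a c e eb : R) :
  psi * lam = 1 -> mu != 0 -> b = Bt + mu *: A + nu *: x ->
  Xv + a *: A + c *: x =
  (e *: x + psi *: (lam *: Xv) - (eb *: x + psi *: ((lam * (a / mu)) *: Bt)))
  + (a / mu) *: b + (lam * (c - a / mu * nu - e + eb)) *: (psi *: x).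
Proof.
move=> pl mu0 ->.
have l0 : lam != 0 by apply: contra_eq_neq pl => ->; rewrite mulr0 eq_sym oner_eq0.
have lp : psi = lam^-1 by apply: (mulIf l0); rewrite pl mulVf.
by apply/rowP => i; rewrite !mxE lp; field; rewrite mu0 l0.
Qed.
End ConformalCombinations.

Section ConformalChange.
Context {R : realType} {n : nat} {M : manifold R n}.
Variables (x Xi : M -> 'rV[R]_n.+2) (nabla : connection M)
  (h T : M -> 'rV[R]_n -> 'rV[R]_n -> R).
Hypotheses (sx : smooth_fun [set: M] x) (sXi : smooth_fun [set: M] Xi)
  (xXi : forall q, [set: M] q -> spanning_at x Xi x q)
  (gauss : forall p X Y, [set: M] p -> smooth_field_near p X ->
    smooth_field_near p Y ->
    mderiv (fun q => mderiv x q (Y q)) p (X p) =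
      mderiv x p (nabla p (X p) Y) + h p (X p) (Y p) *: Xi p
      + T p (X p) (Y p) *: x p)
  (dXi : forall p v, [set: M] p ->
    exists u s, mderiv Xi p v = mderiv x p u + s *: x p)
  (nd : nondegenerate_on [set: M] h).

Lemma inherited_statistical : statistical [set: M] nabla h.
Proof.
apply: (gauss_statistical openT sx sXi sx xXi gauss nd dXi) => p v _.
by exists v, 0; rewrite scale0r addr0.
Qed.

Variable p0 : M.

(** The last claim is the Xi-component of the derivative of the constant [b]. *)
Lemma constant_decomposition (b : 'rV[R]_n.+2) :
  exists (beta : M -> 'rV[R]_n) (mu nu : M -> R),
  [/\ smooth_field [set: M] beta, smooth_fun [set: M] mu, smooth_fun [set: M] nu,
    forall q, b = mderiv x q (beta q) + mu q *: Xi q + nu q *: x q &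
    forall q v, mderiv mu q v = - h q v (beta q)].
Proof.
have [w wE] := choice (fun q => xXi (I : [set: M] q) b).
have [mu muE] := choice wE; have [nu nuE] := choice muE.
exists w, mu, nu.
have oT : open [set: M] by exact: openT.
have [sw smu snu] := frame_smooth sx sXi sx xXi oT (fun q H => H)
  (smooth_fun_cst _ b) (fun q _ => nuE q).
split=> // q v.
have E : 0 = mderiv (fun q => mderiv x q (w q) + mu q *: Xi q + nu q *: x q) q v.
  rewrite -[LHS](mderiv_cst b q v).
  by apply: mderiv_near; apply: filterE.
have [u [s Eu]] := dXi v (I : [set: M] q).
have := gauss_frame_derivative oT sx sXi sx gauss v oT (I : [set: M] q)
  (fun q H => H) sw smu snu.
rewrite -E Eu => E'.
have dx := smooth_fun_mdiff sx (I : [set: M] q).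
have E0 : mderiv x q (nabla q v w + mu q *: u + nu q *: v)
    + (h q v (w q) + mderiv mu q v) *: Xi q
    + (T q v (w q) + mu q * s + mderiv nu q v) *: x q = mderiv x q 0.
  rewrite (mderiv0v dx) [RHS]E' !(mderivDv _ _ dx) !(mderivZv _ _ dx).
  by rewrite combo_constant.
have [_ /eqP] := frame_unique sx xXi (I : [set: M] q)
  (etrans E0 (combo_pure _ (Xi q) (x q))).
by rewrite addrC addr_eq0 => /eqP.
Qed.

(** The triple (psi x, b, psi x) satisfies a Gauss formula for the connection
    [nabla'] and the metric [g'], with constant transversal vector b and no
    component along psi x. *)
Lemma conformally_flat_near : exists (U : set M) (nabla' : connection M) (g' : metric M),
  [/\ open U, U p0, statistical U nabla' g', flat_on U nabla'
    & conf_proj_equivalent_on U nabla h nabla' g'].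
Proof.
have sth := inherited_statistical.
have hlin := metric_linear (stat_metric sth).
have hsym := Defs.metric_sym (stat_metric sth).
have [alpha alphaE] := coframe sx xXi (I : [set: M] p0).
set b := Xi p0.
have [beta [mu [nu [_ smu _ bE dmu]]]] := constant_decomposition b.
have oT : open [set: M] by exact: openT.
pose lam q := covec alpha (x q).
have slam : smooth_fun [set: M] lam := smooth_covec alpha oT sx.
have dx p := smooth_fun_mdiff sx (I : [set: M] p).
have lam0 : lam p0 = 1.
  have := alphaE 0 0 1.
  by rewrite (mderiv0v (dx p0)) scale0r !add0r scale1r.
have covb : covec alpha b = 0.
  have := alphaE 0 1 0.
  by rewrite (mderiv0v (dx p0)) scale0r add0r addr0 scale1r.
have mu0 : mu p0 = 1.
  have E0 : mderiv x p0 (beta p0) + mu p0 *: Xi p0 + nu p0 *: x p0 =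
    mderiv x p0 0 + 1 *: Xi p0 + 0 *: x p0.
    by rewrite -bE (mderiv0v (dx p0)) scale0r add0r addr0 scale1r.
  by have [] := frame_unique sx xXi (I : [set: M] p0) E0.
pose U : set M := [set q | 0 < lam q] `&` [set q | 0 < mu q].
have opos (f : M -> R) : smooth_fun [set: M] f -> open [set q | 0 < f q].
  move=> sf; apply: (@open_comp _ _ f [set r | 0 < r]); last exact: open_gt.
  by move=> q _; exact: smooth_fun_continuous sf.
have oU : open U by apply: openI; exact: opos.
have Up0 : U p0 by split; rewrite /= ?lam0 ?mu0 ltr01.
have UT : U `<=` [set: M] by [].
have slamU := smooth_fun_sub UT slam; have smuU := smooth_fun_sub UT smu.
have lamN q : U q -> lam q != 0 by move=> [/= H _]; rewrite gt_eqF.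
have muN q : U q -> mu q != 0 by move=> [_ /= H]; rewrite gt_eqF.
pose psi q := (lam q)^-1; pose phi q := (mu q)^-1.
have spsi : smooth_fun U psi := smooth_funV oU lamN slamU.
have sphi : smooth_fun U phi := smooth_funV oU muN smuU.
have psilam q : U q -> psi q * lam q = 1 by move=> Uq; rewrite mulVf // lamN.
pose F q := psi q *: x q.
have sxU := smooth_fun_sub UT sx.
have sF : smooth_fun U F := smooth_funZ oU spsi sxU.
have dpsi p := smooth_fun_mdiff spsi (p := p).
have FE p v : U p -> mderiv F p v = mderiv psi p v *: x p + psi p *: mderiv x p v.
  by move=> Up; exact: mderivZ (dpsi p Up) (dx p).
have covF q : U q -> covec alpha (F q) = 1.
  by move=> Uq; apply: etrans (linearZ _ _) _; exact: psilam.
have covdF q v : U q -> covec alpha (mderiv F q v) = 0.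
  move=> Uq; rewrite -(mderiv_covec alpha v (smooth_fun_mdiff sF Uq)).
  rewrite -[RHS](mderiv_cst (1 : R) q v).
  by apply: (mderiv_eq_on _ oU Uq) => r Ur; exact: covF.
pose nabla' : connection M := fun p v Y => nabla p v Y
  + (lam p * mderiv psi p v) *: Y p + (lam p * mderiv psi p (Y p)) *: v
  - (h p v (Y p) / mu p) *: beta p.
pose g' : metric M := fun p v w => phi p * psi p * h p v w.
pose T' (p : M) (v w : 'rV[R]_n) : R := 0.
pose cb : M -> 'rV[R]_n.+2 := fun=> b.
have scb : smooth_fun U cb by exact: smooth_fun_cst.
have span' q : U q -> spanning_at F cb F q.
  move=> Uq w; have [v [a [c ->]]] := xXi (I : [set: M] q) w.
  exists (lam q *: v - (lam q * (a / mu q)) *: beta q), (a / mu q).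
  eexists.
  rewrite (mderivBv _ _ (smooth_fun_mdiff sF Uq)) (FE q (lam q *: v) Uq).
  rewrite (FE q (_ *: beta q) Uq) !(mderivZv _ _ (dx q)).
  exact: conformal_span (psilam q Uq) (muN q Uq) (bE q).
have gauss' p X Y : U p -> smooth_field_near p X -> smooth_field_near p Y ->
    mderiv (fun q => mderiv F q (Y q)) p (X p) =
      mderiv F p (nabla' p (X p) Y) + g' p (X p) (Y p) *: cb p + T' p (X p) (Y p) *: F p.
  move=> Up nX nY; set v := X p.
  have [V [oV Vp VU sY]] := smooth_field_near_sub oU Up nY.
  have spY := smooth_fun_mderiv oV (smooth_fun_sub VU spsi) sY.
  have sxY := smooth_fun_mderiv oV (smooth_fun_sub VU sxU) sY.
  have E : mderiv (fun q => mderiv F q (Y q)) p v =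
      mderiv (fun q => mderiv psi q (Y q)) p v *: x p
      + mderiv psi p (Y p) *: mderiv x p v
      + (mderiv psi p v *: mderiv x p (Y p)
      + psi p *: (mderiv x p (nabla p v Y) + h p v (Y p) *: Xi p
                  + T p v (Y p) *: x p)).
    rewrite -(gaussE gauss v (I : [set: M] p) nY).
    rewrite -(mderivZ v (smooth_fun_mdiff spY Vp) (dx p)).
    rewrite -(mderivZ v (dpsi p Up) (smooth_fun_mdiff sxY Vp)).
    have d1 := smooth_fun_mdiff (smooth_funZ oV spY (smooth_fun_sub VU sxU)) Vp.
    have d2 := smooth_fun_mdiff (smooth_funZ oV (smooth_fun_sub VU spsi) sxY) Vp.
    rewrite -(mderivD v d1 d2).
    by apply: (mderiv_eq_on _ oV Vp) => q Vq; exact: (FE q (Y q) (VU q Vq)).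
  have [r E'] := conformal_gauss (mderiv x p (nabla p v Y)) (mderiv x p (Y p))
    (mderiv x p v) (h p v (Y p)) (T p v (Y p))
    (mderiv (fun q => mderiv psi q (Y q)) p v) (mderiv psi p v)
    (mderiv psi p (Y p)) (mderiv psi p (nabla' p v Y))
    (psilam p Up) (muN p Up) (bE p).
  have E2 : mderiv F p (nabla' p v Y) = mderiv psi p (nabla' p v Y) *: x p
     + psi p *: (mderiv x p (nabla p v Y) + (lam p * mderiv psi p v) *: mderiv x p (Y p)
       + (lam p * mderiv psi p (Y p)) *: mderiv x p v
       - (h p v (Y p) / mu p) *: mderiv x p (beta p)).
    rewrite FE //; congr (_ + _ *: _).
    by rewrite (mderivBv _ _ (dx p)) !(mderivDv _ _ (dx p)) !(mderivZv _ _ (dx p)).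
  rewrite -E2 -E in E'.
  (* The form alpha is 1 on F, so it vanishes on the derivatives of dF(Y); it also
     vanishes on b, and only the multiple r of F is left. *)
  have r0 : r = 0.
    have cY : covec alpha (mderiv (fun q => mderiv F q (Y q)) p v) = 0.
      have sFY := smooth_fun_mderiv oV (smooth_fun_sub VU sF) sY.
      rewrite -(mderiv_covec alpha v (smooth_fun_mdiff sFY Vp)).
      rewrite -[RHS](mderiv_cst (0 : R) p v).
      by apply: (mderiv_eq_on _ oV Vp) => q /VU Uq; exact: covdF.
    have covD u w : covec alpha (u + w) = covec alpha u + covec alpha w.
      exact: linearD.
    have covZ a u : covec alpha (a *: u) = a * covec alpha u by exact: linearZ.
    have := congr1 (covec alpha) E'.
    rewrite cY covD covD (covdF _ _ Up) (covZ _ b) covb mulr0 !add0r.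
    by rewrite (covZ _ (F p)) (covF p Up) mulr1.
  by rewrite E' r0.
exists U, nabla', g'.
have dcb p v : mderiv cb p v = 0 by exact: mderiv_cst.
split; [exact: oU|exact: Up0| | |].
- apply: (gauss_statistical (h := g') (T := T') oU sF scb sF span' gauss').
  + move=> p v Up gv.
    have hv w : h p v w = 0.
      have := gv w; rewrite /g' => /eqP; rewrite !mulf_eq0 !invr_eq0.
      by rewrite (negbTE (muN p Up)) (negbTE (lamN p Up)) => /eqP.
    exact: (nd (I : [set: M] p) hv).
  + move=> p v Up; exists 0, 0.
    by rewrite dcb (mderiv0v (smooth_fun_mdiff sF Up)) scale0r addr0.
  by move=> p v Up; exists v, 0; rewrite scale0r addr0.
- apply: (gauss_flat (h := g') (T := T') oU sF scb sF span' gauss') => [p v Up|//].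
  exact: dcb.
exists phi, psi; split; [by split| |by []|].
- by move=> p [/= lp mp]; split; rewrite invr_gt0.
move=> p X Y Z Up nX nY nZ; have [/= lp mp] := Up.
have dmud := smooth_fun_mdiff smuU Up.
rewrite (mderiv_ln _ (smooth_fun_mdiff sphi Up)) ?invr_gt0 //.
rewrite !(mderiv_ln _ (dpsi p Up)) ?invr_gt0 // (mderivV _ dmud mp) dmu.
rewrite /nabla' /psi /phi !invrK.
(* What remains is an identity in the values of h, by linearity in the first
   argument. *)
have hD u v z : h p (u + v) z = h p u z + h p v z.
  by rewrite -[u]scale1r hlin // mul1r scale1r.
have hZ a u z : h p (a *: u) z = a * h p u z.
  have h0 : h p 0 z = 0.
    by have := hlin p (-1) 0 0 z I; rewrite scaler0 addr0 mulN1r addNr.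
  by rewrite -[a *: u]addr0 hlin // h0 addr0.
rewrite -scaleNr !hD !hZ (hsym _ (Z p)) //.
have mN := muN p Up.
by field.
Qed.
End ConformalChange.

Theorem theorem5 (R : realType) (n : nat)
    (N : manifold R n.+2) (nablaN nablaN' : connection N) (gN : metric N)
    (theta : chart R n.+2 N) (M : manifold R n) (f : M -> N)
    (xi : M -> 'rV[R]_n.+2) (nabla : connection M)
    (h T : M -> 'rV[R]_n -> 'rV[R]_n -> R) (S : M -> 'rV[R]_n -> 'rV[R]_n)
    (tau sigma : M -> 'rV[R]_n -> R)
    (N_connected : connected [set: N])
    (N_dually_flat : dually_flat nablaN nablaN' gN)
    (theta_affine : affine_coordinates nablaN theta)
    (f_centro_affine : centro_affine_immersion gN theta f xi)
    (f_gauss : gauss_formula nablaN theta f xi nabla h T)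
    (f_weingarten : weingarten_formula nablaN theta f xi S tau sigma)
    (f_nondegenerate : nondegenerate_on [set: M] h)
    (f_equiaffine : forall p v, tau p v = 0) :
  conf_proj_flat nabla h.
Proof.
have [atheta dtheta theta_flat] := theta_affine.
have [[_ cN _] _ _ _] := N_dually_flat.
have [[sf _] [sxi _ _] span] := f_centro_affine.
pose x : M -> 'rV[R]_n.+2 := theta \o f.
pose Xi (q : M) : 'rV[R]_n.+2 := mderiv theta (f q) (xi q).
have oT : open [set: M] by exact: openT.
have sx : smooth_fun [set: M] x := smooth_theta_f atheta dtheta sf.
have sXi : smooth_fun [set: M] Xi := smooth_theta_along atheta dtheta sxi.
have dth := theta_mdiff atheta dtheta.
have dx p : mdifferentiable x p := smooth_fun_mdiff sx (I : [set: M] p).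
have pushE := mderiv_theta_pushforward atheta dtheta sf.
have radE := mderiv_theta_radial atheta dtheta.
have combE p v a b :
    mderiv theta (f p) (Defs.pushforward f p v + a *: xi p + b *: radial theta (f p))
    = mderiv x p v + a *: Xi p + b *: x p.
  by rewrite !(mderivDv _ _ (dth _)) !(mderivZv _ _ (dth _)) pushE radE.
have xXi q : [set: M] q -> spanning_at x Xi x q.
  move=> _ w; rewrite -(mderiv_theta_sum atheta dtheta w (f q)).
  have [v [a [b ->]]] := span q (\sum_i w 0 i *: coord_field theta i (f q)).
  by exists v, a, b.
have gauss p X Y : [set: M] p -> smooth_field_near p X -> smooth_field_near p Y ->
    mderiv (fun q => mderiv x q (Y q)) p (X p) =
      mderiv x p (nabla p (X p) Y) + h p (X p) (Y p) *: Xi p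
      + T p (X p) (Y p) *: x p.
  move=> _ nX nY; rewrite -combE -(f_gauss p X Y nX nY).
  have wE : (fun q => mderiv theta (f q) (Defs.pushforward f q (Y q))) =
      (fun q => mderiv x q (Y q)) by apply/funext => q; exact: pushE.
  rewrite (mderiv_theta_along atheta dtheta cN theta_flat) wE //.
  exact: (push_mdiff oT sx (I : [set: M] p) nY).
have dXi p v : [set: M] p ->
    exists u s, mderiv Xi p v = mderiv x p u + s *: x p.
  move=> _; exists (- S p v), (sigma p v).
  rewrite -(mderiv_theta_along atheta dtheta cN theta_flat);
    last exact: (smooth_fun_mdiff sXi (I : [set: M] p)).
  have pushN : - Defs.pushforward f p (S p v) = Defs.pushforward f p (- S p v).
    apply: (mderiv_theta_inj atheta dtheta (q := f p)).
    rewrite pushE -[- S p v]scaleN1r -[- Defs.pushforward _ _ _]scaleN1r.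
    by rewrite (mderivZv _ _ (dth _)) pushE (mderivZv _ _ (dx p)).
  by rewrite f_weingarten f_equiaffine pushN combE scale0r addr0.
split; first exact: (inherited_statistical sx sXi xXi gauss dXi f_nondegenerate).
move=> p0.
exact: (conformally_flat_near sx sXi xXi gauss dXi f_nondegenerate p0).
Qed.
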